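(* Let $q,M\ge1$. Let $F:\mathbb R^q\times\mathbb R^q\to\mathbb C^M$ be essentially bounded and ordinary Zak-quasiperiodic, with components that are locally VMO on an open neighborhood of $[-2,3]^{2q}$. If $M\le q$, then $$\operatorname*{ess\,inf}_{z\in[0,1]^{2q}}\|F(z)\|=0 .$$ Conversely, if $M>q$, there are smooth ordinary Zak-quasiperiodic maps $F:\mathbb R^q\times\mathbb R^q\to\mathbb C^M$ with no common zero, i.e. with $F(z)\ne0$ for every $z\in\mathbb R^{2q}$.
   Context: A measurable function $F:\mathbb R^q\times\mathbb R^q\to\mathbb C^M$ is ordinary Zak-quasiperiodic if $F(u+n,v+m)=e^{2\pi i n\cdot v}F(u,v)$ for all $n,m\in\mathbb Z^q$ and almost every $(u,v)$. For a locally integrable $H$ and a cube $Q$, put $H_Q=\frac1{|Q|}\int_QH$ and $\operatorname{osc}_Q(H)=\frac1{|Q|}\int_Q\|H-H_Q\|$. $H$ is locally VMO on an open set $U\subset\mathbb R^n$ if for every compact $K\subset U$, $\sup\{\operatorname{osc}_Q(H):Q\subset K\text{ a cube of side length }\ell(Q)\le r\}\to0$ as $r\searrow0$. *)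

(* Defs.v *)
From HB Require Import structures.
From mathcomp Require Import all_boot all_order all_algebra.
From mathcomp Require Import all_classical all_reals all_analysis.
From mathcomp Require Import ess_sup_inf.
From mathcomp Require Import complex.

Set Implicit Arguments.
Unset Strict Implicit.
Unset Printing Implicit Defensive.
Import Order.TTheory GRing.Theory Num.Theory.
Import numFieldNormedType.Exports.

Local Open Scope classical_set_scope.
Local Open Scope ring_scope.

Definition box (R : realType) (n : nat) (a b : 'rV[R]_n) : set 'rV[R]_n :=
  [set x | forall i, a 0 i <= x 0 i <= b 0 i].

(* The truncation at 0 gives volume 0 to an empty box. *)
Definition box_volume (R : realType) (n : nat) (a b : 'rV[R]_n) : R :=
  \prod_(i < n) Num.max 0 (b 0 i - a 0 i).

(* The index set D makes the covering family countable, possibly finite or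
   empty. Without the empty family the empty set would get measure 1 when
   n = 0, since every box of 'rV_0 is a point of volume 1. *)
Definition lebesgue_outer (R : realType) (n : nat) (A : set 'rV[R]_n) :
    \bar R :=
  ereal_inf [set s | exists (D : set nat) (a b : nat -> 'rV[R]_n),
    A `<=` \bigcup_(k in D) box (a k) (b k) /\
    s = (\esum_(k in D) (box_volume (a k) (b k))%:E)%E].

Section lebesgue_outer_measure.
Variables (R : realType) (n : nat).
Local Open Scope ereal_scope.
Local Notation mu := (@lebesgue_outer R n).

Let vol_ge0 (a b : 'rV[R]_n) : 0 <= (box_volume a b)%:E.
Proof. by rewrite lee_fin; apply: prodr_ge0 => i _; rewrite le_max lexx. Qed.

Let outer_ge0 A : 0 <= mu A.
Proof.
apply: le_ereal_inf_tmp => _ [D [a [b [_ ->]]]].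
by apply: esum_ge0 => k _; exact: vol_ge0.
Qed.

Let outer0 : mu set0 = 0.
Proof.
apply/eqP; rewrite eq_le outer_ge0 andbT; apply: ereal_inf_lbound.
by exists set0, (fun=> 0%R), (fun=> 0%R); split => //; rewrite esum_set0.
Qed.

Let le_outer : {homo mu : A B / A `<=` B >-> A <= B}.
Proof.
move=> A B AB; apply: ereal_inf_le_tmp => _ [D [a [b [BD ->]]]].
by exists D, a, b; split => //; exact: subset_trans AB BD.
Qed.

Let outer_sigma_subadditive : sigma_subadditive mu.
Proof.
move=> A; have [[i ioo]|] := pselect (exists i, mu (A i) = +oo).
  rewrite (eseries_pinfty _ _ ioo) ?leey// => k _.
  by rewrite -ltNye (lt_le_trans _ (outer_ge0 _)).
rewrite -forallNE => Aoo.
suff add2e (e : {posnum R}) :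
    mu (\bigcup_k A k) <= \sum_(i <oo) mu (A i) + e%:num%:E.
  by apply/lee_addgt0Pr => _/posnumP[].
rewrite (le_trans _ (epsilon_trick _ _ _))//.
pose P k (B : set nat * (nat -> 'rV[R]_n) * (nat -> 'rV[R]_n)) :=
  A k `<=` \bigcup_(j in B.1.1) box (B.1.2 j) (B.2 j) /\
  \esum_(j in B.1.1) (box_volume (B.1.2 j) (B.2 j))%:E <=
    mu (A k) + (e%:num / (2 ^ k.+1)%:R)%:E.
have [G PG] : {G : nat -> _ & forall k, P k (G k)}.
  apply: (@choice _ _ P) => k; rewrite /P.
  have en1 : (0 < e%:num / (2 ^ k.+1)%:R :> R)%R by [].
  have fk : mu (A k) \is a fin_num.
    by rewrite ge0_fin_numE// ltey; apply/eqP; exact: Aoo.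
  have [x [D [a [b [AD ->]]]] xS] := lb_ereal_inf_adherent en1 fk.
  by exists (D, a, b); split => //; exact/ltW.
pose f (p : nat * nat) : \bar R :=
  (box_volume ((G p.1).1.2 p.2) ((G p.1).2 p.2))%:E.
have f_ge0 p : 0 <= f p by exact: vol_ge0.
have /card_esym/ppcard_eqP[g] := card_nat2.
pose D := [set p : nat * nat | (G p.1).1.1 p.2].
apply: (@le_trans _ _ (\esum_(p in D) f p)).
  apply: ereal_inf_lbound.
  exists (g @^-1` D), (fun k => (G (g k).1).1.2 (g k).2),
    (fun k => (G (g k).1).2 (g k).2); split.
    move=> t [i _ /(PG i).1[j /= Gj tj]].
    by exists (g^-1%FUN (i, j)); rewrite /= invK ?inE.
  rewrite (reindex_esum (g @^-1` D) D g) => //.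
  split=> //; first by move=> x y _ _; apply: inj; rewrite inE.
  by move=> p Dp; exists (g^-1%FUN p); rewrite /= invK ?inE.
have -> : \esum_(p in D) f p =
    \esum_(i in [set: nat]) \esum_(j in (G i).1.1) f (i, j).
  rewrite (esum_esum (a := fun i j => f (i, j)))//.
  have -> : D = [set: nat] `*`` (fun i => (G i).1.1).
    by apply/seteqP; split => -[i j] //= [].
  by apply: eq_esum => -[].
rewrite -nneseries_esumT; last by move=> i; apply: esum_ge0 => j _; exact: f_ge0.
apply: lee_nneseries => i _; first by move=> _; apply: esum_ge0 => j _; exact: f_ge0.
exact: (PG i).2.
Qed.

HB.instance Definition _ := isOuterMeasure.Build R 'rV[R]_n mu
  outer0 outer_ge0 le_outer outer_sigma_subadditive.

End lebesgue_outer_measure.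

(* Lebesgue measure on R^n, on the sigma-algebra of Lebesgue-measurable
   (Caratheodory-measurable) sets; the carrier of [Rn R n] is ['rV[R]_n]. *)
Definition Rn (R : realType) (n : nat) :=
  caratheodory_type (@lebesgue_outer R n : {outer_measure set _ -> \bar R}).

HB.instance Definition _ (R : realType) (n : nat) :=
  Measurable.on (@Rn R n).

Definition lebesgueRn (R : realType) (n : nat) : set (Rn R n) -> \bar R :=
  (@lebesgue_outer R n : {outer_measure set _ -> \bar R}).

HB.instance Definition _ (R : realType) (n : nat) :=
  Measure.on (@lebesgueRn R n).

Definition vnorm (R : realType) (M : nat) (w : 'rV[R[i]]_M) : R :=
  Num.sqrt (\sum_(j < M) Normc.normc (w 0 j) ^+ 2).

Definition expi (R : realType) (t : R) : R[i] := Complex (cos t) (sin t).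

Section complex_valued.
Variables (R : realType) (n : nat).
Local Notation mu := (@lebesgueRn R n).
Implicit Types (H : 'rV[R]_n -> R[i]) (f : 'rV[R]_n -> R).
Implicit Types (Q K U : set 'rV[R]_n).

Definition cmeasurable H :=
  measurable_fun [set: Rn R n] (fun z : Rn R n => complex.Re (H z)) /\
  measurable_fun [set: Rn R n] (fun z : Rn R n => complex.Im (H z)).

Definition clocally_integrable U H := forall K, compact K -> K `<=` U ->
  mu.-integrable K (fun z => (complex.Re (H z))%:E) /\
  mu.-integrable K (fun z => (complex.Im (H z))%:E).

Definition is_cube (l : R) Q :=
  0 < l /\ exists a : 'rV[R]_n, Q = box a (a + const_mx l).

Definition cmean Q H : R[i] :=
  Complex ((fine (mu Q))^-1 * \int[mu]_(z in Q) complex.Re (H z))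
          ((fine (mu Q))^-1 * \int[mu]_(z in Q) complex.Im (H z)).

Definition osc Q H : \bar R :=
  (((fine (mu Q))^-1)%:E *
   \int[mu]_(z in Q) (Normc.normc (H z - cmean Q H))%:E)%E.

(* Adjoining 0 makes the supremum over an empty family of cubes 0, not -oo. *)
Definition osc_sup K H (r : R) : \bar R :=
  ereal_sup ([set 0%E] `|` [set osc Q H | Q in
    [set Q | Q `<=` K /\ exists2 l, l <= r & is_cube l Q]]).

Definition locally_VMO U H := clocally_integrable U H /\
  forall K, compact K -> K `<=` U -> osc_sup K H r @[r --> 0^'+] --> 0%E.

Definition ess_inf_on (A : set 'rV[R]_n) f : \bar R :=
  ereal_sup [set y | {ae mu, forall z : 'rV[R]_n, A z -> (y <= (f z)%:E)%E}].

Fixpoint Ck (k : nat) f : Prop :=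
  continuous f /\
  if k is k'.+1 then
    forall i : 'I_n, let e := delta_mx 0 i : 'rV[R]_n in
      (forall x, derivable f x e) /\ Ck k' (fun x => 'D_e f x)
  else True.

Definition smooth f := forall k, Ck k f.

Definition csmooth H :=
  smooth (fun z => complex.Re (H z)) /\ smooth (fun z => complex.Im (H z)).

End complex_valued.

(* R^q x R^q is identified with R^(q + q): (u, v) is [row_mx u v]. *)
Definition zak_quasiperiodic (R : realType) (q M : nat)
    (F : 'rV[R]_(q + q) -> 'rV[R[i]]_M) :=
  (forall j, cmeasurable (fun z => F z 0 j)) /\
  forall n m : 'rV[int]_q,
    {ae @lebesgueRn R (q + q), forall z : 'rV[R]_(q + q),
      let u := lsubmx z in
      let v := rsubmx z in
      F (row_mx (u + map_mx intr n) (v + map_mx intr m)) =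
      expi (2 * pi * \sum_(k < q) (n 0 k)%:~R * v 0 k) *: F (row_mx u v)}.

(* Main.v *)
(* Case M <= q. Components of F are sections of a line bundle L on the torus
   T^(2q) with c_1(L)^q = q! times the generator. If |F| >= c > 0 almost
   everywhere, cover the torus by cubes of side 2/N with corners on a grid of step
   1/N. By VMO and Markov, F is close to its mean off a small part of each cube,
   so adjacent cubes contain a common point at which F is close to both means
   (up to the quasiperiodicity factor when the edge leaves the fundamental
   domain). The means form a nonvanishing, slowly varying section of L^M on a
   discrete torus. Where the j-th component is large, its phase increments
   trivialise L: they make a cocycle representing c_1(L) vanish on each
   elementary cube there. These q cocycles have zero product, since on every
   cube one of them is zero, but the product is cohomologous to c_1(L)^q, whose
   sum over the torus is positive. No homology is needed: cochains are functions
   of a point and a word of directions, and the sum over the torus of the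
   antisymmetrisation over all words kills coboundaries.

   Case M > q. Take two sections s_0, s_1 of L in the case q = 1 without common
   zero. The coefficients of the polynomial prod_k (s_0(u_k,v_k) +
   s_1(u_k,v_k) X) are q + 1 sections, and they do not vanish together because a
   polynomial ring over a field is a domain. *)
Require Import Defs.
From HB Require Import structures.
From mathcomp Require Import all_boot all_order all_algebra all_fingroup.
From mathcomp Require Import all_classical all_reals all_analysis.
From mathcomp Require Import ess_sup_inf measurable_realfun.
From mathcomp Require Import complex.
From mathcomp Require Import ring lra zify.

Set Implicit Arguments.
Unset Strict Implicit.
Unset Printing Implicit Defensive.
Import Order.TTheory GRing.Theory Num.Theory.
Import numFieldNormedType.Exports.

Local Open Scope classical_set_scope.
Local Open Scope ring_scope.

(** * Cup products of cochains on a discrete torus *)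

Section words.
Variable I : eqType.
Implicit Types w : seq I.

Definition swapat p w :=
  take p w ++ (if drop p w is a :: b :: v then b :: a :: v else drop p w).

Lemma swapat_cat p (u v : seq I) a b :
  size u = p -> swapat p (u ++ [:: a, b & v]) = u ++ [:: b, a & v].
Proof. by move=> <-; rewrite /swapat take_size_cat// drop_size_cat. Qed.

Lemma split_at_pair p w : (p.+1 < size w)%N ->
  exists u a b v, w = u ++ [:: a, b & v] /\ size u = p.
Proof.
move=> h; exists (take p w).
case E : (drop p w) => [|a [|b v]].
- by move: (size_drop p w); rewrite E /=; lia.
- by move: (size_drop p w); rewrite E /=; lia.
exists a, b, v; rewrite -E cat_take_drop; split=> //.
by rewrite size_take_min; lia.
Qed.

End words.

Lemma map_swapat (I J : eqType) (f : I -> J) p (w : seq I) :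
  map f (swapat p w) = swapat p (map f w).
Proof.
rewrite /swapat map_cat map_take -map_drop.
by case: (drop p w) => [|a [|b v]].
Qed.

Section cup_product.
Variables (R : numFieldType) (I : finType) (T : finZmodType) (e : I -> T).
Variables (base : seq I).
Hypothesis ubase : uniq base.

Local Notation cochain := (T -> seq I -> R).
Implicit Types (Phi Psi K : cochain) (w : seq I) (t : T -> I -> I -> R).

(** Once [base] lists every direction, as [zbase] does, this is evaluation on a top-dimensional
    cube, made alternating by hand. *)
Definition altsum (f : seq I -> R) :=
  \sum_(s : {perm I}) (-1) ^+ s * f (map s base).

Definition cint Phi := \sum_x altsum (Phi x).

(** Only images of [base] under permutations are evaluated, so default values on words of other
    lengths or with repeated letters are invisible. *)
Lemma eq_cint Phi Psi :
  (forall x w, size w = size base -> uniq w -> Phi x w = Psi x w) ->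
  cint Phi = cint Psi.
Proof.
move=> h; apply: eq_bigr => x _; apply: eq_bigr => s _.
rewrite h ?size_map// map_inj_uniq//; exact: perm_inj.
Qed.

Lemma cintD Phi Psi : cint (fun x w => Phi x w + Psi x w) = cint Phi + cint Psi.
Proof.
rewrite /cint -big_split; apply: eq_bigr => x _ /=.
by rewrite /altsum -big_split; apply: eq_bigr => s _ /=; rewrite mulrDr.
Qed.

Lemma cintN Phi : cint (fun x w => - Phi x w) = - cint Phi.
Proof.
rewrite /cint -sumrN; apply: eq_bigr => x _ /=.
by rewrite /altsum -sumrN; apply: eq_bigr => s _ /=; rewrite mulrN.
Qed.

Lemma cintB Phi Psi : cint (fun x w => Phi x w - Psi x w) = cint Phi - cint Psi.
Proof. by rewrite cintD cintN. Qed.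

(** Since [base] has no repeated letter, exchanging two neighbours is composition of each
    permutation with a transposition, which flips the sign. *)
Lemma altsum_swap p (f : seq I -> R) : (p.+1 < size base)%N ->
  altsum (fun w => f (swapat p w)) = - altsum f.
Proof.
move=> /split_at_pair[u [a [b [v [hb hu]]]]].
have ut : map (tperm a b) base = swapat p base.
  move: ubase; rewrite hb swapat_cat// cat_uniq /= !inE !negb_or.
  move=> /and5P[_ /and3P[au bu uv] /andP[ab av] bv _].
  rewrite map_cat /= tpermL tpermR; congr (_ ++ [:: _, _ & _]).
    apply: map_id_in => x xu; rewrite tpermD//.
      by apply: contraNneq au => ->.
    by apply: contraNneq bu => ->.
  apply: map_id_in => x xv; rewrite tpermD//.
    by apply: contraNneq av => ->.
  by apply: contraNneq bv => ->.
have ab : a != b.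
  by move: ubase; rewrite hb cat_uniq /= !inE !negb_or => /and5P[_ _ /andP[]].
rewrite /altsum (reindex_inj (mulgI (tperm a b))) /= -sumrN.
apply: eq_bigr => s _; rewrite odd_permM odd_tperm ab addTb signrN mulNr.
congr (- (_ * f _)).
rewrite -map_swapat -ut -map_comp.
by apply: eq_map => x /=; rewrite permM tpermK.
Qed.

Lemma cint_swap p Phi : (p.+1 < size base)%N ->
  cint (fun x w => Phi x (swapat p w)) = - cint Phi.
Proof. by move=> hp; rewrite /cint -sumrN; apply: eq_bigr => x _; rewrite altsum_swap. Qed.

(** The rotation carries the first letter past all the others, and in even length that is an odd
    number of neighbour swaps. *)
Lemma cint_rot1 Phi : ~~ odd (size base) -> (0 < size base)%N ->
  cint (fun x w => Phi x (rot 1 w)) = - cint Phi.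
Proof.
move=> ev b0.
have H k Psi : (k < size base)%N -> cint (fun x w =>
    Psi x (take k (behead w) ++ take 1 w ++ drop k (behead w)))
    = (-1) ^+ k * cint Psi.
  elim: k Psi => [Psi _|k IH Psi hk].
    rewrite mul1r; apply: eq_cint => x [|a w] //= hw _.
    by rewrite !take0 drop0.
  rewrite exprSr -mulrA mulN1r -(cint_swap _ hk) -IH ?(ltnW hk)//.
  apply: eq_cint => x [|c w] /= hw _; first by rewrite -hw in hk.
  rewrite -hw ltnS in hk; rewrite !take0.
  have [u [b [v [-> st]]]] : exists u b v, w = u ++ b :: v /\ size u = k.
    exists (take k w); case E : (drop k w) => [|b v].
      by move: (size_drop k w); rewrite E /=; lia.
    by exists b, v; rewrite -E cat_take_drop size_takel// ltnW.
  have st' : size (u ++ [:: b]) = k.+1 by rewrite size_cat st addn1.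
  rewrite (take_size_cat _ st) (drop_size_cat _ st) swapat_cat// -cat1s catA.
  by rewrite (take_size_cat _ st') (drop_size_cat _ st') -catA.
have := H (size base).-1 Phi; rewrite prednK// leqnn => /(_ isT).
have -> : (-1) ^+ (size base).-1 = -1 :> R.
  by rewrite -signr_odd; case: (size base) ev b0 => //= m; rewrite negbK => ->.
rewrite mulN1r => <-; apply: eq_cint => x [|a w] //= hw _.
rewrite /rot /= take0 drop0; congr (Phi _ _).
have hs : (size base).-1 = size w by rewrite -hw.
by rewrite hs take_size drop_size.
Qed.

(** For a fixed permutation the shift does not depend on [x], so it only reindexes the sum over the
    torus. *)
Lemma cint_shift Phi :
  cint (fun x w => Phi (x + \sum_(a <- take 1 w) e a) w) = cint Phi.
Proof.
rewrite /cint /altsum exchange_big [RHS]exchange_big; apply: eq_bigr => s _ /=.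
by rewrite [RHS](reindex_inj (addIr (\sum_(a <- take 1 (map s base)) e a))).
Qed.

(* A cochain assigns a value to a lattice point and a word of directions. Left
   multiplication by a cochain reads its letters from the word and moves the
   base point along them; [muld] is multiplication by the sum of all unit edges,
   so that the coboundary is a graded commutator with it. *)
Definition muld K : cochain :=
  fun x w => if w is a :: w' then K (x + e a) w' else 0.
Definition mul1 (b : T -> I -> R) K : cochain :=
  fun x w => if w is a :: w' then b x a * K (x + e a) w' else 0.
Definition mul2 t K : cochain :=
  fun x w => if w is a :: b :: w' then t x a b * K (x + e a + e b) w' else 0.
Definition mul2s (ts : seq (T -> I -> I -> R)) K : cochain := foldr mul2 K ts.

(** Cup product with a cochain of degree [p] on the left. Identities are proved behind an arbitrary
    such prefix so that they apply inside longer products. *)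
Definition premul p (A : cochain) K : cochain := fun x w =>
  A x (take p w) * K (x + \sum_(a <- take p w) e a) (drop p w).

Lemma cint_swap_premul p A K K' : (p.+1 < size base)%N ->
  (forall y a b v, a != b -> K' y [:: a, b & v] = K y [:: b, a & v]) ->
  cint (premul p A K') = - cint (premul p A K).
Proof.
move=> hp h; rewrite -(cint_swap _ hp); apply: eq_cint => x w hw uw.
rewrite -hw in hp; have [u [a [b [v [E hu]]]]] := split_at_pair hp; subst w.
rewrite swapat_cat// /premul !take_size_cat// !drop_size_cat// h//.
by move: uw; rewrite cat_uniq /= !inE !negb_or => /and5P[_ _ /andP[]].
Qed.

Lemma cint_swap_premul2 p A K K' : (p.+2 < size base)%N ->
  (forall y a b c v, uniq [:: a; b; c] ->
     K' y [:: a, b, c & v] = K y [:: a, c, b & v]) ->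
  cint (premul p A K') = - cint (premul p A K).
Proof.
move=> hp h; rewrite -(cint_swap _ hp); apply: eq_cint => x w hw uw.
rewrite -hw in hp; have [u [b [c [v [E hu]]]]] := split_at_pair hp; subst w.
rewrite swapat_cat// /premul.
case/lastP: u uw hp hu {hw} => [//|u a] uw hp; rewrite size_rcons => -[hu].
rewrite -!cats1 -!catA !take_size_cat// !drop_size_cat//= h//.
move: uw; rewrite -cats1 -catA cat_uniq /= => /and3P[_ _].
by rewrite !inE !negb_or -!andbA => /and5P[-> -> _ -> _].
Qed.

(* The coboundary of [t] vanishes after antisymmetrisation in the letters. *)
Definition cocycle t := forall x a b c, uniq [:: a; b; c] ->
  let d a b c := t (x + e a) b c - t x a b in
  d a b c - d b a c + d b c a - d c b a + d c a b - d a c b = 0.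

Lemma cint_muld_mul2 t p A K : (p.+2 < size base)%N -> cocycle t ->
  cint (premul p A (muld (mul2 t K))) = cint (premul p A (mul2 t (muld K))).
Proof.
move=> hp ct.
(* The commutator with the three letters permuted by [f]; the base point of [K] is symmetric in them
   and does not change. *)
pose D (f : I -> I -> I -> I * I * I) : cochain := fun y w =>
  if w is a :: b :: c :: v then
    let: (a', b', c') := f a b c in
    (t (y + e a') b' c' - t y a' b') * K (y + e a + e b + e c) v
  else 0.
apply/eqP; rewrite -subr_eq0 -cintB.
rewrite (@eq_cint _ (premul p A (D (fun a b c => (a, b, c))))); last first.
  move=> x w hw _; rewrite /premul -mulrBr; congr (_ * _).
  have : (2 < size (drop p w))%N by rewrite size_drop; lia.
  by case: (drop p w) => [|a [|b [|c v]]]//= _; rewrite mulrBl.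
have hp1 : (p.+1 < size base)%N by exact: ltn_trans hp.
have s1 f g : (forall a b c, f a b c = g b a c) ->
    cint (premul p A (D f)) = - cint (premul p A (D g)).
  move=> fg; apply: cint_swap_premul => // y a b [|c v] _ //=.
  by rewrite fg; case: (g b a c) => [[? ?] ?]; rewrite (addrAC y).
have s2 f g : (forall a b c, f a b c = g a c b) ->
    cint (premul p A (D f)) = - cint (premul p A (D g)).
  move=> fg; apply: cint_swap_premul2 => // y a b c v _ /=.
  by rewrite fg; case: (g a c b) => [[? ?] ?]; rewrite (addrAC _ (e b)).
set J := cint _.
have e1 : cint (premul p A (D (fun a b c => (b, a, c)))) = - J by rewrite /J; exact: s1.
have e2 : cint (premul p A (D (fun a b c => (a, c, b)))) = - J by rewrite /J; exact: s2.
have e3 : cint (premul p A (D (fun a b c => (b, c, a)))) = J.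
  by rewrite (s1 _ (fun a b c => (a, c, b)))// e2 opprK.
have e4 : cint (premul p A (D (fun a b c => (c, a, b)))) = J.
  by rewrite (s2 _ (fun a b c => (b, a, c)))// e1 opprK.
have e5 : cint (premul p A (D (fun a b c => (c, b, a)))) = - J.
  by rewrite (s1 _ (fun a b c => (c, a, b)))// e4.
(* Each of the six orders of the letters contributes [J] once its sign is included, while the signed
   sum vanishes pointwise by the cocycle identity. *)
have : J *+ 6 = 0.
  have -> : J *+ 6 = J - - J + J - - J + J - - J.
    by rewrite !opprK !mulrS mulr0n addr0 !addrA.
  rewrite -{1}e1 -{1}e3 -{1}e5 -{1}e4 -{1}e2 /J -!(cintB, cintD).
  rewrite [LHS](_ : _ = cint (fun _ _ => 0)); last first.
    apply: eq_cint => x w hw uw; rewrite /premul -!(mulrBr, mulrDr).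
    have : (2 < size (drop p w))%N by rewrite size_drop; lia.
    have := drop_uniq p uw.
    case: (drop p w) => [|a [|b [|c v]]]//= uv _.
    set y := x + _; rewrite -!(mulrBl, mulrDl).
    have /(ct y) : uniq [:: a; b; c].
      by move: uv; rewrite /= !inE !negb_or => /and3P[/and3P[-> -> _] /andP[-> _] _].
    move=> /= cty; rewrite [X in _ * (X * _)](_ : _ = 0) ?mul0r ?mulr0//.
    by rewrite -[RHS]cty; ring.
  by rewrite /cint big1// => x _; rewrite /altsum big1// => s _; rewrite mulr0.
by move/eqP; rewrite mulrn_eq0.
Qed.

(** Associativity: the factor [t] joins the prefix, whose degree grows by two. This drives the
    inductions on lists of factors. *)
Lemma premul_mul2 p A t K x w : (p.+1 < size w)%N ->
  premul p A (mul2 t K) x w = premul p.+2 (fun x w => if drop p w is [:: a; b] then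
     A x (take p w) * t (x + \sum_(a <- take p w) e a) a b else 0) K x w.
Proof.
move=> /split_at_pair[u [a [b [v [-> hu]]]]]; rewrite /premul take_size_cat// drop_size_cat//=.
have -> : u ++ [:: a, b & v] = (u ++ [:: a; b]) ++ v by rewrite -catA.
have su : size (u ++ [:: a; b]) = p.+2 by rewrite size_cat /= hu addn2.
rewrite (take_size_cat _ su) (drop_size_cat _ su) take_size_cat// drop_size_cat//.
by rewrite big_cat /= !big_cons big_nil addr0 !addrA mulrA.
Qed.

Lemma cint_muld_mul2s ts p A K : (p + (size ts).*2 < size base)%N ->
  (forall t, List.In t ts -> cocycle t) ->
  cint (premul p A (muld (mul2s ts K))) = cint (premul p A (mul2s ts (muld K))).
Proof.
elim: ts p A => [//|t ts IH] p A /= hp ct.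
rewrite cint_muld_mul2; [|by move: hp; lia|by apply: ct; left].
have e3 K' : cint (premul p A (mul2 t K')) = cint (premul p.+2 (fun x w =>
  if drop p w is [:: a; b] then
     A x (take p w) * t (x + \sum_(a <- take p w) e a) a b else 0) K').
  by apply: eq_cint => x w hw _; rewrite premul_mul2//; move: hp; lia.
rewrite !e3 IH//; first by move: hp; lia.
by move=> t' h; apply: ct; right.
Qed.

(** It is 1 on words of every length, so a product that ends in it ignores leftover letters;
    [cint_exact] relies on this. *)
Definition cunit : cochain := fun _ _ => 1.
(** The sum of [b] along two consecutive edges. Its antisymmetrisation [asym] is the circulation of
    [b] around the square, that is, the usual coboundary. *)
Definition dform (b : T -> I -> R) : T -> I -> I -> R :=
  fun x a c => b x a + b (x + e a) c.
Definition asym t : T -> I -> I -> R := fun x a c => t x a c - t x c a.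

Lemma premul0 K x w : premul 0 (fun _ _ => 1) K x w = K x w.
Proof. by rewrite /premul take0 drop0 big_nil addr0 mul1r. Qed.

Lemma cint_premul_mul2 p A t K : (p.+1 < size base)%N ->
  cint (premul p A (mul2 t K)) = cint (premul p.+2 (fun x w =>
    if drop p w is [:: a; b] then
      A x (take p w) * t (x + \sum_(a <- take p w) e a) a b else 0) K).
Proof. by move=> hp; apply: eq_cint => x w hw _; rewrite premul_mul2// hw. Qed.

Lemma cint_premul_mul1 p A b K : (p < size base)%N ->
  cint (premul p A (mul1 b K)) = cint (premul p.+1 (fun x w =>
    if drop p w is [:: a] then
      A x (take p w) * b (x + \sum_(a <- take p w) e a) a else 0) K).
Proof.
move=> hp; apply: eq_cint => x w hw _.
rewrite -hw in hp; rewrite /premul.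
have [u [c [v [-> st]]]] : exists u c v, w = u ++ c :: v /\ size u = p.
  exists (take p w); case E : (drop p w) => [|c v].
    by move: (size_drop p w); rewrite E /=; lia.
  by exists c, v; rewrite -E cat_take_drop size_takel// ltnW.
have su : size (u ++ [:: c]) = p.+1 by rewrite size_cat st addn1.
have E : u ++ c :: v = (u ++ [:: c]) ++ v by rewrite -catA.
rewrite (take_size_cat _ st) (drop_size_cat _ st) /= E.
rewrite (take_size_cat _ su) (drop_size_cat _ su) (take_size_cat _ st).
by rewrite (drop_size_cat _ st) big_cat /= big_cons big_nil addr0 addrA mulrA.
Qed.

Lemma cint_mul1_muld_mul2s us vs b p A K :
  (p + (size us).*2 + (size vs).*2 + 1 < size base)%N ->
  (forall t, List.In t vs -> cocycle t) ->
  cint (premul p A (mul2s us (mul1 b (muld (mul2s vs K))))) =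
  cint (premul p A (mul2s us (mul1 b (mul2s vs (muld K))))).
Proof.
move=> + cv; elim: us p A => [|t us IH] p A /= hp.
  by rewrite !cint_premul_mul1 ?cint_muld_mul2s//; lia.
by rewrite !cint_premul_mul2 ?IH//; lia.
Qed.

Lemma mul2s_cunit us x w s : ((size us).*2 <= size w)%N ->
  mul2s us cunit x (w ++ s) = mul2s us cunit x w.
Proof. by elim: us x w => [//|t us IH] x [|a [|b w]]//= hw; rewrite IH. Qed.

Lemma mul2s_mul1_cunit us b vs x w s :
  ((size us).*2 + (size vs).*2 < size w)%N ->
  mul2s us (mul1 b (mul2s vs cunit)) x (w ++ s) = mul2s us (mul1 b (mul2s vs cunit)) x w.
Proof.
elim: us x w => [|t us IH] x w /= hw; last first.
  by case: w hw => [|a [|c w]]//= hw; rewrite IH.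
by case: w hw => [|a w]//= hw; rewrite mul2s_cunit.
Qed.

Lemma mul2s_muld_cunit us b vs x w : size w = ((size us).*2 + (size vs).*2).+2 ->
  mul2s us (mul1 b (mul2s vs (muld cunit))) x w = mul2s us (mul1 b (mul2s vs cunit)) x w.
Proof.
elim: us x w => [|t us IH] x [|a w] //=.
  move=> hw; congr (_ * _).
  elim: vs (x + e a) w hw => [|t vs IH] y v /= hv; first by case: v hv.
  by case: v hv => [|a' [|c' v]]//= hv; rewrite IH//=; lia.
by case: w => [|c w]//= hw; rewrite IH//; lia.
Qed.

Lemma mul2sD us K K1 K2 x w : (forall x w, K x w = K1 x w + K2 x w) ->
  mul2s us K x w = mul2s us K1 x w + mul2s us K2 x w.
Proof.
move=> h; elim: us x w => [//|t us IH] x [|a [|c w]]//=; rewrite ?addr0//.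
by rewrite IH mulrDr.
Qed.

(* [dform b] is [muld b + b muld]. Moving [muld] to the front in one term and to
   the end in the other gives two words that differ by a rotation, which is odd
   because the length is even. *)
Lemma cint_exact us b vs : ((size us).*2 + (size vs).*2).+2 = size base ->
  (forall t, List.In t us -> cocycle t) -> (forall t, List.In t vs -> cocycle t) ->
  cint (mul2s us (mul2 (dform b) (mul2s vs cunit))) = 0.
Proof.
move=> hn cu cv.
set K1 := muld (mul1 b (mul2s vs cunit)); set K2 := mul1 b (muld (mul2s vs cunit)).
rewrite (@eq_cint _ (fun x w => mul2s us K1 x w + mul2s us K2 x w)); last first.
  move=> x w _ _; apply: mul2sD => y [|a [|c v]]//=; rewrite ?mulr0 ?addr0//.
  by rewrite /dform mulrDl addrC.
set G := mul2s us (mul1 b (mul2s vs cunit)).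
have ev : ~~ odd (size base) by rewrite -hn /= !negbK oddD !odd_double.
have b0 : (0 < size base)%N by rewrite -hn.
rewrite cintD.
have -> : cint (mul2s us K2) = cint G.
  rewrite -(eq_cint (fun x w _ _ => premul0 _ x w)) cint_mul1_muld_mul2s//; last by rewrite -hn; lia.
  by apply: eq_cint => x w hw _; rewrite premul0 mul2s_muld_cunit// hw.
suff -> : cint (mul2s us K1) = - cint G by rewrite addNr.
rewrite -(eq_cint (fun x w _ _ => premul0 _ x w)) -cint_muld_mul2s//; last by rewrite -hn; lia.
(* A [muld] in front drops the first letter and moves the base point along it. As [G] ignores its
   last letter, the result is the translate of [G] on the rotated word. *)
rewrite -(cint_rot1 _ ev b0) -[RHS]cint_shift.
apply: eq_cint => x w hw _; rewrite premul0.
case: w hw => [|a w] hw; first by rewrite -hw in b0.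
rewrite /= take0 big_cons big_nil addr0 rot1_cons -cats1 /G mul2s_mul1_cunit//.
by move: hw => /=; lia.
Qed.

Lemma cocycle_add t b : cocycle t -> cocycle (fun x a c => t x a c + dform b x a c).
Proof.
move=> ct x a1 a2 a3 ua d; have := ct x _ _ _ ua; rewrite /= => h.
rewrite -[RHS]h /d /dform (addrAC x (e a2) (e a1)) (addrAC x (e a3) (e a2)).
by rewrite (addrAC x (e a3) (e a1)); ring.
Qed.

(** The factors are replaced by [t] one at a time from the left, the finished ones being collected
    in [us]. Each replacement changes the integral by a product with one exact factor, which is zero
    by [cint_exact]. *)
Lemma cint_telescope us bs t : ((size us).*2 + (size bs).*2) = size base ->
  (forall t, List.In t us -> cocycle t) -> cocycle t ->
  cint (mul2s us (mul2s
    [seq (fun x a c => t x a c + dform b x a c) | b <- bs] cunit)) =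
  cint (mul2s us (mul2s (nseq (size bs) t) cunit)).
Proof.
move=> + + ct; elim: bs us => [//|b bs IH] us hn cu.
rewrite [map _ _]/=; set vs := map _ bs.
have h x w : mul2s us (mul2s ((fun x a c => t x a c + dform b x a c) :: vs) cunit) x w
   = mul2s us (mul2 t (mul2s vs cunit)) x w + mul2s us (mul2 (dform b) (mul2s vs cunit)) x w.
  by apply: mul2sD => {}x [|a [|c {}w]] /=; rewrite ?addr0// mulrDl.
rewrite (eq_cint (fun x w _ _ => h x w)) cintD cint_exact ?addr0//; first last.
- by rewrite /vs; elim: (bs) => [//|b' bs' IHs] t' /= [<-|/IHs//]; exact: cocycle_add.
- by rewrite size_map -hn /=; lia.
have e2 ss : mul2s us (mul2 t (mul2s ss cunit)) = mul2s (us ++ [:: t]) (mul2s ss cunit).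
  by rewrite /mul2s foldr_cat.
rewrite e2 IH; last 2 first.
- by rewrite size_cat -hn /=; lia.
- by move=> t'; rewrite List.in_app_iff /= => -[/cu//|[<-|]].
by rewrite -e2.
Qed.

(** Swapping the two letters of a factor changes the sign of the integral, so both halves of
    [asym t] contribute equally and each factor gives a 2. *)
Lemma cint_asym ts p A K : (p + (size ts).*2 <= size base)%N ->
  cint (premul p A (mul2s (map asym ts) K)) = 2 ^+ size ts * cint (premul p A (mul2s ts K)).
Proof.
elim: ts p A => [|t ts IH] p A /= hp; first by rewrite mul1r.
have hp1 : (p.+1 < size base)%N by lia.
rewrite exprS -mulrA (cint_premul_mul2 _ t)// -IH; last by lia.
rewrite -cint_premul_mul2//; set K' := mul2s _ _.
have -> : cint (premul p A (mul2 (asym t) K')) = cint (premul p A (mul2 t K'))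
    - cint (premul p A (mul2 (fun x a c => t x c a) K')).
  rewrite -cintB; apply: eq_cint => x w hw _; rewrite /premul -mulrBr; congr (_ * _).
  by case: (drop p w) => [|a [|c v]] /=; rewrite ?subr0// -mulrBl.
rewrite (cint_swap_premul (K := mul2 t K') A (K' := mul2 (fun x a c => t x c a) K') hp1).
  by rewrite opprK mulr_natl mulr2n.
by move=> y a c v _ /=; rewrite addrAC.
Qed.

End cup_product.

(** * The top power of the curvature class and the cup length argument *)

Section cup_length.
Variables (R : realFieldType) (q : nat) (T : finZmodType) (e : 'I_(q + q) -> T).
Variables (h : 'I_q -> T -> R).
Hypothesis h_inv : forall k a x, a != lshift q k -> h k (x + e a) = h k x.
Hypothesis h_ge0 : forall k x, 0 <= h k x.
Hypothesis h_gt0 : exists x, forall k, 0 < h k x.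

(** A cochain representing c_1(L): the sum over [k] of du_k cup dv_k with weight [h k]. *)
Definition curvature : T -> 'I_(q + q) -> 'I_(q + q) -> R := fun x a b =>
  \sum_(k < q) ((a == lshift q k) && (b == rshift q k))%:R * h k x.

(** The order u_1, v_1, u_2, v_2, ... makes the identity permutation contribute a product of
    positive weights. *)
Definition zbase : seq 'I_(q + q) :=
  flatten [seq [:: lshift q k; rshift q k] | k <- enum 'I_q].

Lemma size_zbase : size zbase = (q + q)%N.
Proof.
rewrite /zbase size_flatten /shape -map_comp.
rewrite (@eq_map _ _ _ (fun=> 2)%N)// -/(nseq _ _).
rewrite -[in RHS](size_enum_ord q); elim: (enum 'I_q) => //= k s ->; lia.
Qed.

Lemma zbase_uniq : uniq zbase.
Proof.
apply: (@leq_size_uniq _ (enum 'I_(q + q))); first exact: enum_uniq.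
  move=> a _; apply/flatten_mapP; case: (split_ordP a) => k ->.
    by exists k; rewrite ?mem_enum// inE eqxx.
  by exists k; rewrite ?mem_enum// !inE eqxx orbT.
by rewrite size_zbase size_enum_ord.
Qed.

Lemma curv_shift x a b c : a != b -> a != c -> curvature (x + e a) b c = curvature x b c.
Proof.
move=> ab ac; apply: eq_bigr => k _.
have [E|] := eqVneq b (lshift q k); last by rewrite !mul0r.
by rewrite h_inv// -E.
Qed.

(** A weight depends only on its own u_k, so for distinct letters the shifts disappear and the
    twelve terms cancel formally. *)
Lemma curv_cocycle : cocycle e curvature.
Proof.
move=> x a b c /=; rewrite !inE !negb_or => /and3P[/andP[ab ac] bc _].
have ca : c != a by rewrite eq_sym. have ba : b != a by rewrite eq_sym.
have cb : c != b by rewrite eq_sym.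
by rewrite !curv_shift//; ring.
Qed.

Lemma mul2s_curv x w0 (js : seq 'I_q) (f g : 'I_q -> 'I_(q + q)) :
  uniq (flatten [seq [:: f j; g j] | j <- js]) ->
  mul2s e (nseq (size js) curvature) (@cunit _ _ _) x
    (flatten [seq [:: f j; g j] | j <- js] ++ w0)
  = \prod_(j <- js) curvature x (f j) (g j).
Proof.
elim: js x => [|j js IH] x /=; first by rewrite big_nil.
move=> /andP[fj /andP[gj us]]; rewrite big_cons IH//; congr (_ * _).
apply: eq_big_seq => i ijs.
have fi : f i \in flatten [seq [:: f j; g j] | j <- js].
  by apply/flatten_mapP; exists i => //; rewrite inE eqxx.
have gi : g i \in flatten [seq [:: f j; g j] | j <- js].
  by apply/flatten_mapP; exists i => //; rewrite !inE eqxx orbT.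
move: fj; rewrite inE negb_or => /andP[_ fj].
rewrite curv_shift ?curv_shift//; last 2 first.
- by apply: contraNneq gj => ->.
- by apply: contraNneq gj => ->.
- by apply: contraNneq fj => ->.
- by apply: contraNneq fj => ->.
Qed.

(** The factor of index [j] is evaluated at [x] moved along the letters [u] read before it, which is
    why it has to vanish along duplicate-free words from [x]. *)
Lemma mul2s_eq0 (J : eqType) (tau : J -> T -> 'I_(q + q) -> 'I_(q + q) -> R)
    (js : seq J) K x j : j \in js ->
  (forall u a c, uniq (u ++ [:: a; c]) ->
    tau j (x + \sum_(d <- u) e d) a c = 0) ->
  forall w, uniq w -> mul2s e (map tau js) K x w = 0.
Proof.
move=> jjs t0 w uw.
suff H u y v : w = u ++ v -> y = x + \sum_(d <- u) e d ->
    mul2s e (map tau js) K y v = 0.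
  by apply: (H [::]) => //; rewrite big_nil addr0.
elim: js jjs u y v => [//|j' js IH] /=; rewrite inE => /predU1P[<-|/IH{}IH] u y v wE yE.
  case: v wE => [|a [|c v]]//= wE.
  have : uniq ((u ++ [:: a; c]) ++ v) by rewrite -catA -wE.
  by rewrite yE cat_uniq => /andP[ua _]; rewrite t0 ?mul0r.
case: v wE => [|a [|c v]]//= wE; rewrite (IH (u ++ [:: a; c])) ?mulr0//.
  by rewrite -catA.
by rewrite big_cat /= !big_cons big_nil addr0 !addrA yE.
Qed.

(** The permutation matrix is block diagonal with two equal blocks, so its determinant is the square
    of a sign. *)
Lemma perm_pairing_even (s : {perm 'I_(q + q)}) (p : {ffun 'I_q -> 'I_q}) :
  (forall k, s (lshift q k) = lshift q (p k)) ->
  (forall k, s (rshift q k) = rshift q (p k)) -> (-1) ^+ s = 1 :> R.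
Proof.
move=> hl hr.
have injp : injective p.
  by move=> k k' /(congr1 (lshift q)); rewrite -!hl => /perm_inj /lshift_inj.
rewrite -det_perm.
have -> : perm_mx s =
    block_mx (perm_mx (perm injp)) 0 0 (perm_mx (perm injp)) :> 'M[R]_(q + q).
  apply/matrixP => i j; do 2!rewrite [LHS]mxE.
  case: (split_ordP i) => i' ->; case: (split_ordP j) => j' ->;
    rewrite ?(hl, hr) ?(block_mxEul, block_mxEur, block_mxEdl, block_mxEdr) ?mxE ?permE;
    by rewrite ?eq_lshift ?eq_rshift ?eq_lrshift ?eq_rlshift.

by rewrite det_ublock det_perm -expr2 sqrr_sign.
Qed.

(** A permutation with nonzero contribution carries each pair (u_k, v_k) to such a pair, hence is
    even. All terms are therefore nonnegative, and the identity at the point of [h_gt0] gives a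
    positive one. *)
Lemma cint_curv_gt0 : 0 < cint zbase (mul2s e (nseq q curvature) (@cunit _ _ _)).
Proof.
have E x (s : {perm 'I_(q + q)}) :
    mul2s e (nseq q curvature) (@cunit _ _ _) x (map s zbase) =
    \prod_k curvature x (s (lshift q k)) (s (rshift q k)).
  have -> : nseq q curvature = nseq (size (enum 'I_q)) curvature by rewrite size_enum_ord.
  rewrite /zbase map_flatten -map_comp.
  rewrite -[X in mul2s _ _ _ _ X]cats0 (mul2s_curv x [::] (js := enum 'I_q)
    (f := fun k => s (lshift q k)) (g := fun k => s (rshift q k))).
    by rewrite big_enum.
  have := zbase_uniq; rewrite -(map_inj_uniq (@perm_inj _ s)) /zbase map_flatten.
  by rewrite -map_comp.
have cge0 x a b : 0 <= curvature x a b by apply: sumr_ge0 => k _; rewrite mulr_ge0.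
have ge0 x (s : {perm 'I_(q + q)}) : 0 <= (-1) ^+ s *
    mul2s e (nseq q curvature) (@cunit _ _ _) x (map s zbase).
  rewrite E; set P := \prod_k _.
  have [->|P0] := eqVneq P 0; first by rewrite mulr0.
  have hk k : exists k', s (lshift q k) = lshift q k' /\ s (rshift q k) = rshift q k'.
    move: P0; rewrite /P (bigD1 k)//= mulf_eq0 negb_or => /andP[+ _].
    case: (boolP [exists k', (s (lshift q k) == lshift q k') &&
                             (s (rshift q k) == rshift q k')]).
      by move=> /existsP[k' /andP[/eqP ? /eqP ?]] _; exists k'.
    rewrite negb_exists => /forallP h0; rewrite /curvature big1 ?eqxx// => k' _.
    by rewrite (negbTE (h0 k')) mul0r.
  have hk' k : exists k', (s (lshift q k) == lshift q k') && (s (rshift q k) == rshift q k').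
    by have [k' [-> ->]] := hk k; exists k'; rewrite !eqxx.
  have hp k := andP (xchooseP (hk' k)).
  rewrite (@perm_pairing_even s [ffun k => xchoose (hk' k)]).
  - by rewrite mul1r; apply: prodr_ge0.
  - by move=> k; rewrite ffunE; have [/eqP ? _] := hp k.
  - by move=> k; rewrite ffunE; have [_ /eqP ?] := hp k.
have [x0 hx0] := h_gt0.
rewrite /cint (bigD1 x0)//= ltr_wpDr//.
  by apply: sumr_ge0 => x _; apply: sumr_ge0 => s _; exact: ge0.
rewrite /altsum (bigD1 1%g)//= ltr_wpDr//; first by apply: sumr_ge0 => s _; exact: ge0.
rewrite odd_perm1 mul1r E; apply: prodr_gt0 => k _; rewrite !perm1.
rewrite /curvature (bigD1 k)//= !eqxx mul1r big1 ?addr0// => k' kk'.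
by rewrite eq_lshift eq_sym (negbTE kk') mul0r.
Qed.

(* This is the statement that [c_1 (L) ^ q] does not vanish, in the form of the
   cup length argument: [q] cocycles representing [c_1 (L)] cannot be chosen so
   that around each point one of them is locally zero. *)
Lemma no_local_trivialisations (b : 'I_q -> T -> 'I_(q + q) -> R) :
  ~ (forall x, exists j, forall u a c, uniq (u ++ [:: a; c]) ->
       asym (fun x a c => curvature x a c + dform e (b j) x a c)
            (x + \sum_(d <- u) e d) a c = 0).
Proof.
move=> h0; have := cint_curv_gt0.
pose tau j x a c := curvature x a c + dform e (b j) x a c.
have H0 : cint zbase (mul2s e (map (fun j => asym (tau j)) (enum 'I_q)) (@cunit _ _ _)) = 0.
  rewrite (eq_cint zbase_uniq (Psi := fun _ _ => 0)).
    by rewrite /cint big1// => x _; rewrite /altsum big1// => s _; rewrite mulr0.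
  move=> x w _ uw; have [j hj] := h0 x.
  by apply: (@mul2s_eq0 _ (fun j => asym (tau j)) _ _ x j) => //; rewrite mem_enum.
(* The same integral is [2 ^+ q] times that of the [q]-th power of [curvature]: first drop the
   antisymmetrisations, then the exact parts. *)
move: H0; rewrite (map_comp (@asym R _ T) tau).
rewrite -(eq_cint zbase_uniq (fun x w _ _ => premul0 e _ x w)) cint_asym; last first.
- by rewrite size_map size_enum_ord size_zbase; lia.
- exact: zbase_uniq.
rewrite (eq_cint zbase_uniq (fun x w _ _ => premul0 e _ x w)).
have -> : map tau (enum 'I_q) =
    [seq (fun x a c => curvature x a c + dform e b x a c) | b <- map b (enum 'I_q)].
  by elim: (enum 'I_q) => //= j s ->.
have := @cint_telescope R _ T e zbase zbase_uniq [::] (map b (enum 'I_q)) curvature.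
rewrite /= => ->; [|by rewrite size_map size_enum_ord size_zbase; lia|by []|
  exact: curv_cocycle].
have sq : size (Finite.enum 'I_q) = q by rewrite -[RHS](size_enum_ord q) enumT.
rewrite !size_map sq => /eqP; rewrite mulf_eq0 expf_eq0 pnatr_eq0 /= andbF /=.
by move=> /eqP ->; rewrite ltxx.
Qed.

End cup_length.

(** * Nonvanishing sections on a discrete torus *)

Section expi.
Variable R : realType.
Implicit Types (s t : R) (w : R[i]).

Lemma expiD s t : expi (s + t) = expi s * expi t.
Proof.
by apply/eqP; rewrite eq_complex /= cosD sinD eqxx addrC eqxx.
Qed.

Lemma expi0 : expi (0 : R) = 1.
Proof. by rewrite /expi cos0 sin0. Qed.

Lemma normc_expi t : Normc.normc (expi t) = 1.
Proof. by rewrite /Normc.normc /expi cos2Dsin2 sqrtr1. Qed.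

Lemma expi2pi : expi (2 * pi : R) = 1.
Proof. by rewrite /expi mulr_natl cos2pi sin2pi. Qed.

Lemma expi_atan w : 0 < complex.Re w ->
  expi (atan (complex.Im w / complex.Re w)) * (Normc.normc w)%:C%C = w.
Proof.
case: w => a b /= a0.
have e1 : 1 + (b / a) ^+ 2 = (a ^+ 2 + b ^+ 2) / a ^+ 2 by field; rewrite gt_eqF.
have e2 : Num.sqrt (1 + (b / a) ^+ 2) = Num.sqrt (a ^+ 2 + b ^+ 2) / a.
  by rewrite e1 sqrtrM ?addr_ge0 ?sqr_ge0// sqrtrV ?sqr_ge0// sqrtr_sqr gtr0_norm.
have s0 : Num.sqrt (a ^+ 2 + b ^+ 2) != 0.
  by rewrite gt_eqF// sqrtr_gt0 ltr_pwDl// ?sqr_ge0// exprn_gt0.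
have ec : cos (atan (b / a)) = a / Num.sqrt (a ^+ 2 + b ^+ 2).
  by rewrite cos_atan e2 invf_div.
have es : sin (atan (b / a)) = b / Num.sqrt (a ^+ 2 + b ^+ 2).
  have := atanK (b / a); rewrite /tan => /(congr1 ( *%R^~ (cos (atan (b / a))))).
  rewrite divfK; last by rewrite ec mulf_neq0 ?invr_neq0// gt_eqF.
  by move=> ->; rewrite ec; field; rewrite s0 gt_eqF.
apply/eqP; rewrite eq_complex /= ec es !mulr0 subr0 add0r.
by rewrite !divfK// !eqxx.
Qed.

(** From cos t = 1 the half-angle formula gives sin (t / 2) = 0, and the sine is positive strictly
    between 0 and pi. *)
Lemma expi_eq1 t : `|t| < 2 * pi -> expi t = 1 -> t = 0.
Proof.
move=> tpi /(congr1 (@complex.Re R)) /= c1.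
have : sin (t / 2) ^+ 2 = 0.
  have := cosD (t / 2) (t / 2); have := cos2Dsin2 (t / 2).
  rewrite -splitr c1 -!expr2 => h1 h2; lra.
move/eqP; rewrite sqrf_eq0 => /eqP s0.
apply/eqP; apply: contraTT isT => t0.
have : 0 < sin (`|t| / 2).
  apply: sin_gt0_pi; rewrite divr_gt0 ?normr_gt0//= ltr_pdivrMr//; lra.
have [tp|tn] := lerP 0 t; first by rewrite ger0_norm// s0 ltxx.
by rewrite ltr0_norm// mulNr sinN s0 oppr0 ltxx.
Qed.

End expi.

Section discrete_section.
Variables (R : realType) (q p : nat).
Local Notation T := 'rV['I_p.+4]_(q + q).
Local Notation N := (p.+4%:R : R).

Definition unitv (a : 'I_(q + q)) : T := delta_mx 0 a.

(* The transition factor of the bundle across the edge [(x, a)] of the discrete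
   torus: it is nontrivial when [a = u_k] leaves the fundamental domain. *)
Definition transition (x : T) (a : 'I_(q + q)) : R :=
  if fintype.split a is inl k then
    if x 0 a == ord_max then 2 * pi * ((x 0 (rshift q k))%:R / N) else 0
  else 0.

(** The curvature is concentrated on the layer where u_k wraps: there the transition angle grows by
    2 pi / N for each step in v_k. *)
Definition slab (k : 'I_q) (x : T) : R := (x 0 (lshift q k) == ord_max)%:R / N.

Lemma unitv_ne (x : T) a b : a != b -> (x + unitv a) 0 b = x 0 b.
Proof. by move=> ab; rewrite !mxE eq_sym (negbTE ab) /= mulr0n addr0. Qed.

Lemma unitv_eq (x : T) a : val ((x + unitv a) 0 a) = ((x 0%R a).+1 %% p.+4)%N.
Proof. by rewrite !mxE !eqxx mulr1n /= (modnDmr (x 0 a) 1 p.+4) addn1. Qed.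

Local Notation curv := (curvature slab).

Lemma curvE (x : T) a b : curv x a b =
  if (fintype.split a, fintype.split b) is (inl k, inr k') then
    if k == k' then slab k x else 0 else 0.
Proof.
rewrite /curvature; case: (split_ordP a) => k ->; last first.
  by rewrite big1// => k' _; rewrite eq_rlshift mul0r.
case: (split_ordP b) => k' ->.
  by rewrite big1// => k2 _; rewrite eq_lrshift andbF mul0r.
rewrite (bigD1 k)//= eqxx big1 ?addr0.
  by rewrite eq_rshift eq_sym; case: eqP; rewrite ?mul1r ?mul0r.
by move=> k2 kk; rewrite eq_lshift eq_sym (negbTE kk) mul0r.
Qed.

Lemma transition_curv (x : T) a c : a != c ->
  expi (2 * pi * curv x c a + transition x c) = expi (transition (x + unitv a) c).
Proof.
move=> ac; rewrite curvE /transition unitv_ne//.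
case: (split_ordP c) ac => k -> ac; last first.
  by rewrite mulr0 addr0.
rewrite /=.
case: (split_ordP a) ac => k' -> ac.
  by rewrite mulr0 add0r unitv_ne// eq_lrshift.
rewrite /slab.
case: eqP => [<-|kk']; last first.
  by rewrite mulr0 add0r unitv_ne// eq_rshift eq_sym; apply/eqP.
case: eqP => xm; last by rewrite mul0r mulr0 addr0.
rewrite unitv_eq -mulrDr -mulrDl.
rewrite mulr1n nat1r.
(* When v_k wraps as well, the left angle is a full turn and the right one is 0, which [expi]
   identifies. *)
have := ltn_ord (x 0 (rshift q k)); rewrite leq_eqVlt => /predU1P[E|lt].
  by rewrite E modnn divff ?pnatr_eq0// mul0r mulr0 mulr1 expi2pi expi0.
by rewrite modn_small.
Qed.

Variables (m : 'I_q -> T -> R[i]) (eta c : R).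
Local Notation normc := Normc.normc.
Hypothesis eta_gt0 : 0 < eta.
Hypothesis m_large : forall x, exists j, c <= normc (m j x).
Hypothesis m_near : forall j x a,
  normc (expi (transition x a) * m j (x + unitv a) - m j x) <= eta.
Hypothesis eta_small : (2 * q + 2)%:R * eta <= c.

Definition ratio j (x : T) a := expi (transition x a) * m j (x + unitv a) / m j x.

(* Only meaningful when the ratio has positive real part. *)
Definition edge_phase j (x : T) a : R :=
  atan (complex.Im (ratio j x a) / complex.Re (ratio j x a)) / (2 * pi).

Lemma normcB w1 w2 : normc w1 - normc w2 <= normc (w1 - w2) :> R.
Proof. by rewrite lerBlDr; have := le_normcD (w1 - w2) w2; rewrite subrK. Qed.

Lemma m_edge j x a : normc (m j x) - eta <= normc (m j (x + unitv a)).
Proof.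
have h := normcB (m j x) (expi (transition x a) * m j (x + unitv a)).
have h2 := m_near j x a; rewrite -normcN opprB in h2.
by rewrite Normc.normcM normc_expi mul1r in h; lra.
Qed.

Lemma m_path j x u :
  normc (m j x) - (size u)%:R * eta <= normc (m j (x + \sum_(d <- u) unitv d)).
Proof.
elim: u x => [|a u IH] x; first by rewrite big_nil addr0 mul0r subr0.
rewrite big_cons addrA; apply: le_trans (IH _).
by rewrite /= -natr1; have := m_edge j x a; lra.
Qed.

Lemma ratio_near j x a : 2 * eta <= normc (m j x) ->
  2^-1 <= complex.Re (ratio j x a) /\ `|complex.Im (ratio j x a)| <= 2^-1.
Proof.
move=> h; have m0 : m j x != 0.
  by apply: contraTneq h => ->; rewrite Normc.normc0 -ltNge mulr_gt0.
have : normc (ratio j x a - 1) <= 2^-1.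
  rewrite /ratio -(divff m0) -mulrBl Normc.normcM Normc.normcV.
  rewrite ler_pdivrMr; last by rewrite (lt_le_trans _ h)// mulr_gt0.
  by apply: le_trans (m_near j x a) _; lra.
case: (ratio j x a) => u v /=; rewrite subr0 => /(le_trans _) H; split.
  have : `|u - 1| <= 2^-1.
    by apply: H; rewrite -sqrtr_sqr ler_wsqrtr// lerDl sqr_ge0.
  by rewrite ler_norml => /andP[]; lra.
by apply: H; rewrite -sqrtr_sqr ler_wsqrtr// lerDr sqr_ge0.
Qed.

(** The ratio is within 1/2 of 1, so its imaginary part is at most its real part in absolute value,
    and the angle is at most pi / 4. *)
Lemma edge_phase_expi j x a : 2 * eta <= normc (m j x) ->
  expi (2 * pi * edge_phase j x a) * (normc (ratio j x a))%:C%C = ratio j x a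
  /\ `|2 * pi * edge_phase j x a| <= pi / 4.
Proof.
move=> /(ratio_near a)[hr hi].
have pi0 : 2 * pi != 0 :> R by rewrite mulf_neq0// gt_eqF// pi_gt0.
have r0 : 0 < complex.Re (ratio j x a) by apply: lt_le_trans hr.
rewrite /edge_phase [2 * pi * _]mulrC divfK//; split; first exact: expi_atan.
move: hi; rewrite -atan1 !ler_norml -atanN => /andP[hi1 hi2].
by rewrite !le_atan// (ler_pdivlMr, ler_pdivrMr)//; lra.
Qed.

(** The torus has side at least 4. The bound keeps the angles in [flat_plaquette] below a full
    turn. *)
Lemma curv_bound (x : T) a b : 0 <= curv x a b <= 4^-1.
Proof.
have h k : 0 <= slab k x <= 4^-1.
  rewrite /slab mulr_ge0 ?invr_ge0//=.
  case: eqP => _; last by rewrite mul0r invr_ge0.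
  by rewrite mul1r lef_pV2 ?posrE// ler_nat.
have h0 : 0 <= (0 : R) <= 4^-1 by rewrite lexx invr_ge0 ler0n.
rewrite curvE; case: (fintype.split a) => k //; case: (fintype.split b) => k' //.
by case: ifP.
Qed.

(** Both routes across the square lead to the same value of [m j], so the total angle is a multiple
    of 2 pi. Four phases of at most pi / 4 and a curvature term of at most pi / 2 keep it below 2
    pi, so it is zero. *)
Lemma flat_plaquette j (x : T) a b : a != b ->
  3 * eta <= normc (m j x) ->
  asym (fun x a c => curv x a c + dform unitv (edge_phase j) x a c) x a b = 0.
Proof.
move=> ab hm.
(* Phases are taken on edges starting at [x] and at its two neighbours; reaching a neighbour costs
   one [eta]. *)
have m2 : 2 * eta <= normc (m j x) by move: hm eta_gt0; lra.
have m2' d : 2 * eta <= normc (m j (x + unitv d)).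
  by move: (m_edge j x d) hm eta_gt0; lra.
have [E1 B1] := edge_phase_expi a m2.
have [E2 B2] := edge_phase_expi b (m2' a).
have [E3 B3] := edge_phase_expi b m2.
have [E4 B4] := edge_phase_expi a (m2' b).
set tau := asym _ _ _ _.
have tauE : tau = (curv x a b + (edge_phase j x a + edge_phase j (x + unitv a) b))
  - (curv x b a + (edge_phase j x b + edge_phase j (x + unitv b) a)) by [].
have pi0 : 0 < pi :> R by exact: pi_gt0.
suff : 2 * pi * tau = 0.
  by move/eqP; rewrite !mulf_eq0 pnatr_eq0/= (gt_eqF pi0) => /eqP.
apply: expi_eq1.
  have /andP[c1 c1'] := curv_bound x a b; have /andP[c2 c2'] := curv_bound x b a.
  have c3 : pi * curv x a b <= pi / 4 by rewrite ler_pM2l.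
  have c4 : pi * curv x b a <= pi / 4 by rewrite ler_pM2l.
  have c5 : 0 <= pi * curv x a b by rewrite mulr_ge0// ltW.
  have c6 : 0 <= pi * curv x b a by rewrite mulr_ge0// ltW.
  move: B1 B2 B3 B4; rewrite !ler_norml => /andP[? ?] /andP[? ?] /andP[? ?] /andP[? ?].
  by rewrite ltr_norml tauE; apply/andP; split; lra.
set W1 := ratio j x a in E1; set W2 := ratio j (x + unitv a) b in E2.
set W3 := ratio j x b in E3; set W4 := ratio j (x + unitv b) a in E4.
have m0 y : 2 * eta <= normc (m j y) -> m j y != 0.
  by move=> h; apply: contraTneq h => ->; rewrite Normc.normc0 -ltNge mulr_gt0.
have H : expi (2 * pi * curv x a b) * (W1 * W2) = expi (2 * pi * curv x b a) * (W3 * W4).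
  have t1 := transition_curv x ab.
  have t2 : expi (2 * pi * curv x a b + transition x a) = expi (transition (x + unitv b) a).
    by rewrite transition_curv// eq_sym.
  rewrite !expiD in t1 t2.
  rewrite /W1 /W2 /W3 /W4 /ratio (addrAC x (unitv b)) -t1 -t2.
  field; rewrite !m0//.
have nz (w : R[i]) : 2^-1 <= complex.Re w -> w != 0.
  by move=> h; apply/eqP => w0; move: h; rewrite w0 leNgt invr_gt0 ltr0n.
have n1 : normc (W1 * W2) = normc (W3 * W4).
  have := congr1 (@Normc.normc R) H; rewrite Normc.normcM normc_expi mul1r => ->.
  by rewrite Normc.normcM normc_expi mul1r.
have n0 : (normc (W3 * W4))%:C%C != 0 :> R[i].
  apply/eqP => -[] /Normc.eq0_normc/eqP; apply/negP/mulf_neq0; apply: nz.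
    by have [] := ratio_near b m2.
  by have [] := ratio_near a (m2' b).
apply/eqP; rewrite -subr_eq0; apply/eqP.
rewrite tauE mulrBr expiD; apply: (mulIf n0).
have e34 : expi (2 * pi * (curv x b a + (edge_phase j x b + edge_phase j (x + unitv b) a)))
   * (normc (W3 * W4))%:C%C = expi (2 * pi * curv x b a) * (W3 * W4).
  by rewrite -[in RHS]E3 -[in RHS]E4 Normc.normcM !mulrDr !expiD rmorphM /=; ring.
have e12 : expi (2 * pi * (curv x a b + (edge_phase j x a + edge_phase j (x + unitv a) b)))
   * (normc (W3 * W4))%:C%C = expi (2 * pi * curv x a b) * (W1 * W2).
  by rewrite -n1 -[in RHS]E1 -[in RHS]E2 Normc.normcM !mulrDr !expiD rmorphM /=; ring.
have := H; rewrite -e12 -e34 => /(mulIf n0) ->.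
by rewrite -expiD subrr expi0 subrr.
Qed.

Lemma no_discrete_section : False.
Proof.
apply: (@no_local_trivialisations R q T unitv slab _ _ _ edge_phase).
- by move=> k a x ak; rewrite /slab unitv_ne.
- by move=> k x; rewrite /slab mulr_ge0 ?invr_ge0.
- exists (const_mx ord_max) => k.
  by rewrite /slab mxE eqxx mul1r invr_gt0 ltr0n.
move=> x; have [j cj] := m_large x; exists j => u a b uu.
apply: flat_plaquette.
  by move: uu; rewrite cat_uniq /= !inE => /and3P[_ _ /andP[]].
apply: le_trans (m_path j x u).
(* The word has distinct letters, so [u] has at most 2q - 2 of them. Losing one [eta] per letter
   leaves at least [4 * eta] out of [c]. *)
have su : (size u + 2 <= q + q)%N.
  have := max_card (mem (u ++ [:: a; b])).
  by rewrite (card_uniqP uu) card_ord size_cat /=.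
have : (size u + 2 + 2)%:R * eta <= (2 * q + 2)%:R * eta.
  by rewrite ler_pM2r// ler_nat; lia.
by move: eta_small cj eta_gt0; rewrite !natrD; lra.
Qed.

End discrete_section.

(** * Lebesgue measure on R^n *)

Section lebesgue_Rn.
Variable R : realType.

Lemma box_volume_ge0 n (a b : 'rV[R]_n) : 0 <= box_volume a b.
Proof. by apply: prodr_ge0 => i _; rewrite le_max lexx. Qed.

Definition rtail n (x : 'rV[R]_n.+1) : 'rV[R]_n := \row_j x 0 (lift ord0 j).

Lemma box_volumeS n (a b : 'rV[R]_n.+1) : box_volume a b =
  Num.max 0 (b 0 ord0 - a 0 ord0) * box_volume (rtail a) (rtail b).
Proof.
rewrite /box_volume big_ord_recl; congr (_ * _).
by apply: eq_bigr => i _; rewrite !mxE.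
Qed.

Lemma lebesgue_measure_segment (a b : R) :
  (@lebesgue_measure R) `[a, b]%classic = (Num.max 0 (b - a))%:E.
Proof.
rewrite lebesgue_measure_itv/= lte_fin; case: ltP => ab.
  by rewrite -EFinB max_r// subr_ge0 ltW.
by rewrite max_l// subr_le0.
Qed.

Lemma esum_ge_term (D : set nat) (f : nat -> \bar R) k : D k ->
  (forall i, 0 <= f i)%E -> (f k <= \esum_(i in D) f i)%E.
Proof.
move=> Dk f0; rewrite -(@esum_set1 R nat k f (f0 k)).
rewrite esum_mkcond [leRHS]esum_mkcond; apply: le_esum => // i _.
case: ifPn => [|_]; last by case: ifPn.
by rewrite inE => ->; rewrite mem_set.
Qed.

(* Induction on the dimension: the slices at height [t] of the covering boxes
   cover the slice of the box; integrate over [t]. *)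
Lemma box_volume_le_cover n (a b : 'rV[R]_n) (D : set nat) (A B : nat -> 'rV[R]_n) :
  box a b `<=` \bigcup_(k in D) box (A k) (B k) ->
  ((box_volume a b)%:E <= \esum_(k in D) (box_volume (A k) (B k))%:E)%E.
Proof.
elim: n a b D A B => [|n IH] a b D A B cov.
  have [k Dk _] : (\bigcup_(k in D) box (A k) (B k)) a by apply: cov => -[].
  apply: le_trans (@esum_ge_term D (fun k => (box_volume (A k) (B k))%:E) k Dk _).
    by rewrite /box_volume !big_ord0.
  by move=> i; rewrite lee_fin box_volume_ge0.
(* Membership in [D] is part of [S k], so the integrand can be a series over all indices. *)
pose S k := [set t : R | D k /\ A k 0 ord0 <= t <= B k 0 ord0].
pose v k := box_volume (rtail (A k)) (rtail (B k)).
pose f k (t : R) : \bar R := ((v k)%:E * (\1_(S k) t)%:E)%E.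
have v0 k : 0 <= v k by exact: box_volume_ge0.
have f0 k t : (0 <= f k t)%E by rewrite mule_ge0// lee_fin.
have SE k : S k = if pselect (D k) then `[A k 0 ord0, B k 0 ord0]%classic else set0.
  apply/seteqP; case: pselect => Dk; split => t /=; rewrite ?in_itv//=.
  - by case.
  - by case.
have mS k : measurable (S k).
  by rewrite SE; case: pselect => Dk; [exact: measurable_itv|exact: measurable0].
have mI : measurable (`[a 0 ord0, b 0 ord0]%classic : set R) by [].
have slice t : a 0 ord0 <= t <= b 0 ord0 ->
    ((box_volume (rtail a) (rtail b))%:E <= \sum_(k <oo) f k t)%E.
  move=> tab.
  have -> : (\sum_(k <oo) f k t = \esum_(k in [set k | S k t]) (v k)%:E)%E.
    rewrite nneseries_esumT// [RHS]esum_mkcond; apply: eq_esum => k _.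
    rewrite /f indicE; have [kS|kS] := pselect (S k t).
      by rewrite !mem_set// mule1.
    by rewrite !memNset// mule0.
  apply: IH => y yab.
  pose x : 'rV[R]_n.+1 := \row_i (if unlift ord0 i is Some j then y 0 j else t).
  have x0 : x 0 ord0 = t by rewrite mxE unlift_none.
  have xl j : x 0 (lift ord0 j) = y 0 j by rewrite mxE liftK.
  have [|k Dk xk] := cov x.
    move=> i; case: (unliftP ord0 i) => [j ->|->]; last by rewrite x0.
    by rewrite xl; have := yab j; rewrite !mxE.
  exists k; first by split=> //; have := xk ord0; rewrite x0.
  by move=> j; have := xk (lift ord0 j); rewrite xl !mxE.
rewrite box_volumeS mulrC EFinM -lebesgue_measure_segment -integral_cst//.
have mi k : measurable_fun `[a 0 ord0, b 0 ord0]%classic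
    (fun t => (\1_(S k) t)%:E : \bar R).
  apply/measurable_EFinP; exact: (measurable_funS measurableT).
have mf k : measurable_fun `[a 0 ord0, b 0 ord0]%classic (f k).
  by apply: measurable_funeM; exact: mi.
apply: (@le_trans _ _ (\int[@lebesgue_measure R]_(t in `[a 0%R ord0, b 0%R ord0])
    (\sum_(k <oo) f k t))%E).
  apply: ge0_le_integral => //.
  - by move=> t _; rewrite lee_fin box_volume_ge0.
  - by apply: ge0_emeasurable_sum => k *; [exact: f0|exact: mf].
rewrite integral_nneseries// esum_mkcond -nneseries_esumT; last first.
  by move=> k; case: ifPn => // _; rewrite lee_fin box_volume_ge0.
apply: lee_nneseries => k _; first by move=> _; exact: integral_ge0.
rewrite ge0_integralZl_EFin//; last exact: mi.
rewrite integral_indic//; last exact: mS.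
have [Dk|Dk] := pselect (D k).
  rewrite (mem_set Dk) box_volumeS mulrC EFinM lee_wpmul2l ?lee_fin//.
  rewrite -lebesgue_measure_segment le_measure ?inE//; first exact: measurableI (mS k) mI.
  by move=> t [[_ ?] _] /=; rewrite in_itv.
have S0 : S k = set0 by apply/seteqP; split => t // -[].
by rewrite (memNset Dk) S0 set0I measure0 mule0.
Qed.


Lemma lebesgue_outer_box n (a b : 'rV[R]_n) :
  lebesgue_outer (box a b) = (box_volume a b)%:E.
Proof.
apply/eqP; rewrite eq_le; apply/andP; split.
  apply: ereal_inf_lbound; exists [set 0%N], (fun=> a), (fun=> b); split.
    by move=> x xab; exists 0%N.
  by rewrite esum_set1// lee_fin box_volume_ge0.
apply: le_ereal_inf_tmp => _ [D [A [B [cov ->]]]].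
exact: box_volume_le_cover.
Qed.

Lemma lebesgue_outer_shift_le n (v : 'rV[R]_n) (X : set 'rV[R]_n) :
  (lebesgue_outer [set x | X (x + v)%R] <= lebesgue_outer X)%E.
Proof.
apply: le_ereal_inf_tmp => _ [D [A [B [cov ->]]]]; apply: ereal_inf_lbound.
exists D, (fun k => A k - v), (fun k => B k - v); split.
  move=> x /cov[k Dk xk]; exists k => // i.
  by have := xk i; rewrite !mxE lerBlDr lerBrDr.
apply: eq_esum => k _; congr (_%:E); apply: eq_bigr => i _.
by rewrite !mxE opprB addrA subrK.
Qed.

Lemma lebesgue_outer_shift n (v : 'rV[R]_n) (X : set 'rV[R]_n) :
  lebesgue_outer [set x | X (x + v)%R] = lebesgue_outer X.
Proof.
apply/eqP; rewrite eq_le lebesgue_outer_shift_le/=.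
rewrite [leLHS](_ : _ = lebesgue_outer [set x | [set x | X (x + v)%R] (x - v)%R]).
  exact: lebesgue_outer_shift_le.
by congr lebesgue_outer; apply/seteqP; split => x /=; rewrite subrK.
Qed.

Definition set_coord n (x : 'rV[R]_n) (i : 'I_n) (t : R) : 'rV[R]_n :=
  \row_j (if j == i then t else x 0 j).

Lemma box_volume_split n (a b : 'rV[R]_n) (i : 'I_n) (c : R) :
  box_volume a (set_coord b i (Num.min (b 0 i) c)) +
  box_volume (set_coord a i (Num.max (a 0 i) c)) b <= box_volume a b.
Proof.
rewrite /box_volume (bigD1 i)//= [X in _ + X](bigD1 i)//= [leRHS](bigD1 i)//=.
rewrite !mxE eqxx.
set P := \prod_(j < n | j != i) Num.max 0 (b 0 j - a 0 j).
rewrite (eq_bigr (fun j => Num.max 0 (b 0 j - a 0 j))); last first.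
  by move=> j /negbTE ji; rewrite !mxE ji.
rewrite [X in _ + _ * X](eq_bigr (fun j => Num.max 0 (b 0 j - a 0 j))); last first.
  by move=> j /negbTE ji; rewrite !mxE ji.
rewrite -/P -mulrDl ler_wpM2r//.
  by apply: prodr_ge0 => j _; rewrite le_max lexx.
by case: (leP (b 0 i) c) => ?; case: (leP (a 0 i) c) => ?;
  rewrite /Num.max; do ?case: ltP => ?; lra.
Qed.

(** Cutting every box of a cover along the hyperplane yields covers of the two parts with no larger
    total volume. *)
Lemma halfspace_caratheodory n (i : 'I_n) (c : R) :
  (@lebesgue_outer R n : {outer_measure set _ -> \bar R}).-caratheodory
    [set x : 'rV[R]_n | x 0 i <= c].
Proof.
apply: le_caratheodory_measurable => X /=.
apply: le_ereal_inf_tmp => _ [D [A [B [cov ->]]]].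
apply: (@le_trans _ _ (
  \esum_(k in D)
    (box_volume (A k) (set_coord (B k) i (Num.min (B k 0%R i) c)))%:E +
  \esum_(k in D)
    (box_volume (set_coord (A k) i (Num.max (A k 0%R i) c)) (B k))%:E)%E).
  apply: leeD; apply: ereal_inf_lbound.
    exists D, A, (fun k => set_coord (B k) i (Num.min (B k 0 i) c)); split => //.
    move=> x [/cov[k Dk xk] xc]; exists k => // j; have := xk j; rewrite mxE.
    by case: eqVneq => [->|//] /andP[-> ?] /=; rewrite le_min xc andbT.
  exists D, (fun k => set_coord (A k) i (Num.max (A k 0 i) c)), B; split => //.
  move=> x [/cov[k Dk xk] /negP]; rewrite -ltNge => xc; exists k => // j.
  have := xk j; rewrite mxE.
  by case: eqVneq => [->|//] /andP[l ->]; rewrite ge_max l (ltW xc).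
rewrite -esumD; [|by move=> *; rewrite lee_fin box_volume_ge0..].
by apply: le_esum => k _; rewrite -EFinD lee_fin box_volume_split.
Qed.

Lemma measurable_halfspace n (i : 'I_n) (c : R) :
  measurable ([set x : 'rV[R]_n | x 0 i <= c] : set (Rn R n)).
Proof. exact: halfspace_caratheodory. Qed.

Lemma measurable_coord n (i : 'I_n) :
  measurable_fun [set: Rn R n] (fun z : Rn R n => (z : 'rV[R]_n) 0 i).
Proof.
apply: (measurability _ (measurable_realfun.RGenOInfty.measurableE R)).
move=> _ [_ [c ->] <-]; rewrite setTI.
have -> : (fun z : Rn R n => (z : 'rV[R]_n) 0 i) @^-1` `]c, +oo[%classic =
    ~` [set x : 'rV[R]_n | x 0 i <= c].
  by apply/seteqP; split => x /=; rewrite in_itv/= andbT ltNge => /negP.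
exact: measurableC (measurable_halfspace i c).
Qed.

Lemma measurable_box n (a b : 'rV[R]_n) : measurable (box a b : set (Rn R n)).
Proof.
have -> : (box a b : set (Rn R n)) = \bigcap_(i in [set: 'I_n])
    ((fun z : Rn R n => (z : 'rV[R]_n) 0 i) @^-1` `[a 0 i, b 0 i]%classic).
  apply/seteqP; split => x /= h i; first by move=> _ /=; rewrite in_itv/=.
  by have := h i I; rewrite /= in_itv.
apply: fin_bigcap_measurable => // i _.
by rewrite -[X in measurable X]setTI; exact: measurable_coord.
Qed.

Lemma compact_box n (a b : 'rV[R]_n) : compact (box a b).
Proof.
suff -> : box a b = [set v : 'rV[R]_n | forall i, `[a 0 i, b 0 i]%classic (v ord0 i)].
  by apply: (@rV_compact R n (fun i => `[a 0 i, b 0 i]%classic)) => i; exact: segment_compact.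
by apply/seteqP; split => x /= h i; have := h i; rewrite /= in_itv.
Qed.

Lemma cube_volume n (a : 'rV[R]_n) l : 0 <= l ->
  lebesgue_outer (box a (a + const_mx l)) = (l ^+ n)%:E.
Proof.
move=> l0; rewrite lebesgue_outer_box /box_volume; congr (_%:E).
under eq_bigr do rewrite !mxE addrAC subrr add0r max_r//.
by rewrite prodr_const card_ord.
Qed.

(** Turns statements holding almost everywhere into bounds on outer measure, which apply to
    exceptional sets of any kind. *)
Lemma negligible_outer n (X : set 'rV[R]_n) :
  (@lebesgueRn R n).-negligible X -> lebesgue_outer X = 0%E.
Proof.
move=> [B [_ B0 XB]]; apply/eqP; rewrite eq_le; apply/andP; split.
  by rewrite -[leRHS]B0; exact: le_outer_measure.
exact: outer_measure_ge0.
Qed.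

Lemma measurable_fun_normc n (H : 'rV[R]_n -> R[i]) (w : R[i]) :
  cmeasurable H ->
  measurable_fun [set: Rn R n] (fun z : Rn R n => Normc.normc (H z - w)).
Proof.
move=> [mRe mIm].
have -> : (fun z : Rn R n => Normc.normc (H z - w)) = Num.sqrt \o
   (fun z : Rn R n => (complex.Re (H z) - complex.Re w) ^+ 2 +
                      (complex.Im (H z) - complex.Im w) ^+ 2).
  by apply/funext => z /=; case: (H z) => a b; case: w.
apply: measurableT_comp; first by apply: continuous_measurable_fun; exact: sqrt_continuous.
by apply: measurable_funD; apply: measurable_funX; apply: measurable_funB.
Qed.

Lemma normc_ge0 (z : R[i]) : 0 <= Normc.normc z.
Proof. by case: z => a b; exact: sqrtr_ge0. Qed.

Lemma osc_markov n (H : 'rV[R]_n -> R[i]) (a : 'rV[R]_n) (l eps eta : R) :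
  0 < l -> 0 < eta -> cmeasurable H ->
  (osc (box a (a + const_mx l)%R) H <= eps%:E)%E ->
  (lebesgue_outer (box a (a + const_mx l)%R `&`
     [set z | (eta <= Normc.normc (H z - cmean (box a (a + const_mx l)) H))%R])
   <= (eps / eta * l ^+ n)%:E)%E.
Proof.
move=> l0 eta0 mH; set Q := box _ _; set w := cmean _ _.
have V0 : 0 < l ^+ n by exact: exprn_gt0.
have mQ : measurable (Q : set (Rn R n)) by exact: measurable_box.
have mf : measurable_fun (Q : set (Rn R n))
    (fun z : Rn R n => (Normc.normc (H z - w))%:E : \bar R).
  apply/measurable_EFinP; apply: measurable_funTS; exact: measurable_fun_normc.
rewrite /osc -/w.
have -> : @lebesgueRn R n Q = (l ^+ n)%:E by apply: cube_volume; exact: ltW.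
move=> /= h.
(* With the identity as comparison function this is Markov's inequality. *)
have := @le_integral_comp_abse _ (Rn R n) R (@lebesgueRn R n) Q mQ
  (fun z => (Normc.normc (H z - w))%:E) eta id _ _ _ mf eta0.
move=> /(_ (@measurable_id _ _ _)) /(_ (fun _ => id)) /(_ (fun _ _ _ _ => id)).
have -> : [set x | (eta%:E <= `|(Normc.normc (H x - w))%:E|)%E] =
    [set z | eta <= Normc.normc (H z - w)].
  by apply/seteqP; split => x /=; rewrite lee_fin ger0_norm// normc_ge0.
rewrite (_ : (\int[@lebesgueRn R n]_(x in Q) `|(Normc.normc (H x - w))%:E|)%E =
  (\int[@lebesgueRn R n]_(x in Q) (Normc.normc (H x - w))%:E)%E); last first.
  by apply: eq_integral => z _; rewrite /= ger0_norm// normc_ge0.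
move: h; rewrite lee_pdivrMl// => h /le_trans/(_ h).
rewrite -lee_pdivlMl// => /le_trans; apply.
rewrite -!EFinM lee_fin le_eqVlt; apply/orP; left; apply/eqP; ring.
Qed.

End lebesgue_Rn.

(** * From VMO maps to discrete sections *)

Section expi_lipschitz.
Variable R : realType.

Lemma lipschitz_of_derive (f df : R -> R) :
  (forall x : R, is_derive x 1 f (df x)) -> (forall x, `|df x| <= 1) ->
  forall s t, `|f s - f t| <= `|s - t|.
Proof.
move=> fd df1.
have H s t : s <= t -> `|f s - f t| <= `|s - t|.
  move=> st; have cf : {within `[s, t], continuous f}.
    apply: derivable_within_continuous => x _.
    by have := fd x; case.
  have [c _ E] := MVT_segment st (fun x _ => fd x) cf.
  rewrite distrC E normrM distrC -[leRHS]mul1r.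
  exact: ler_wpM2r.
move=> s t; case: (leP s t) => st; first exact: H.
by rewrite distrC (distrC s); apply: H; exact: ltW.
Qed.

Lemma expi_lipschitz (s t : R) : Normc.normc (expi s - expi t) <= 2 * `|s - t|.
Proof.
have hc : `|cos s - cos t| <= `|s - t|.
  apply: (@lipschitz_of_derive cos (fun x => - sin x)) => x.
  by rewrite normrN ler_norml sin_geN1 sin_le1.
have hs : `|sin s - sin t| <= `|s - t|.
  apply: (@lipschitz_of_derive sin cos) => x.
  by rewrite ler_norml cos_geN1 cos_le1.
rewrite /Normc.normc /=.
apply: (@le_trans _ _ (Num.sqrt ((2 * `|s - t|) ^+ 2))); last first.
  by rewrite sqrtr_sqr ger0_norm// mulr_ge0.
rewrite ler_wsqrtr// -(real_normK (num_real (cos s - cos t))).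
rewrite -(real_normK (num_real (sin s - sin t))).
have : `|cos s - cos t| ^+ 2 <= `|s - t| ^+ 2 by rewrite lerXn2r ?nnegrE.
have : `|sin s - sin t| ^+ 2 <= `|s - t| ^+ 2 by rewrite lerXn2r ?nnegrE.
have := sqr_ge0 `|s - t|; rewrite exprMn; lra.
Qed.

End expi_lipschitz.

Section small_bad_sets.
Variables (R : realType) (n : nat).

(** By subadditivity the three sets have joint outer measure at most [2 * v / 3], too little to
    cover [W]. *)
Lemma avoid_small_sets (W X1 X2 Z : set 'rV[R]_n) (v : R) : 0 < v ->
  lebesgue_outer W = v%:E ->
  (lebesgue_outer X1 <= (v / 3)%:E)%E -> (lebesgue_outer X2 <= (v / 3)%:E)%E ->
  lebesgue_outer Z = 0%E ->
  exists z, [/\ W z, ~ X1 z, ~ X2 z & ~ Z z].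
Proof.
move=> v0 Wv X1v X2v Z0; apply: contrapT => h.
pose mu := (@lebesgue_outer R n : {outer_measure set _ -> \bar R}).
have : (mu W <= mu X1 + mu X2 + mu Z)%E.
  apply: (@le_trans _ _ (mu (X1 `|` X2 `|` Z))).
    apply: le_outer_measure => z Wz; apply: contrapT => nz; apply: h; exists z.
    by split=> // ?; apply: nz; [left; left|left; right|right].
  by apply: le_trans (outer_measureU2 _ _ _) _; rewrite leeD2r// outer_measureU2.
rewrite /mu /= Wv Z0 adde0 => /le_trans /(_ (leeD X1v X2v)).
by rewrite -EFinD lee_fin; lra.
Qed.

Lemma outer_measure_exists_fin (M : nat) (Q : set 'rV[R]_n)
    (P : 'I_M -> 'rV[R]_n -> Prop) (e : R) :
  (forall j, (lebesgue_outer (Q `&` [set z | P j z]) <= e%:E)%E) ->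
  (lebesgue_outer (Q `&` [set z | exists j, P j z]) <= (M%:R * e)%:E)%E.
Proof.
move=> h.
pose mu := (@lebesgue_outer R n : {outer_measure set _ -> \bar R}).
(* The finite family is extended to a sequence by empty sets. *)
pose G k := if insub k is Some j then Q `&` [set z | P j z] else set0 : set 'rV[R]_n.
apply: (@le_trans _ _ (mu (\big[setU/set0]_(k < M) G k))).
  apply: le_outer_measure => z [Qz [j Pj]]; rewrite -bigcup_mkord.
  by exists j => /=; rewrite // /G valK.
apply: le_trans (outer_measure_subadditive _ _ _) _.
apply: (@le_trans _ _ (\sum_(k < M) e%:E)%R).
  by apply: lee_sum => k _; rewrite /G valK; exact: h.
by rewrite sumEFin sumr_const card_ord mulr_natl.
Qed.

End small_bad_sets.

Section nonvanishing.
Variables (R : realType) (q M : nat) (F : 'rV[R]_(q + q) -> 'rV[R[i]]_M).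
Hypothesis Fzak : zak_quasiperiodic F.
Local Notation mu := (@lebesgueRn R (q + q)).
Local Notation normc := Normc.normc.

Lemma osc_small (eps : R) : 0 < eps ->
  (exists U : set 'rV[R]_(q + q),
    [/\ open U, box (const_mx (-2)) (const_mx 3) `<=` U
       & forall j : 'I_M, locally_VMO U (fun z => F z 0 j)]) ->
  exists2 r : R, 0 < r & forall j l (Q : set 'rV[R]_(q + q)), l <= r ->
    is_cube l Q -> Q `<=` box (const_mx (-2)) (const_mx 3) ->
    (osc Q (fun z => F z 0%R j) <= eps%:E)%E.
Proof.
move=> e0 [U [oU KU vmo]].
pose K : set 'rV[R]_(q + q) := box (const_mx (-2)) (const_mx 3).
have : \forall r \near 0^'+, forall j : 'I_M,
    (osc_sup K (fun z => F z 0%R j) r < eps%:E)%E.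
  apply: filter_forall => j; have [_ /(_ K (@compact_box _ _ _ _) KU)] := vmo j.
  by move=> /(_ [set y | (y < eps%:E)%E]); apply; apply: open_ereal_lt'; rewrite lte_fin.
move=> h; have : \forall r \near 0^'+, 0 < r /\ forall j : 'I_M,
    (osc_sup K (fun z => F z 0%R j) r < eps%:E)%E.
  by near=> r; split; near: r => //; exact: nbhs_right_gt.
move=> /filter_ex[r [r0 hr]]; exists r => // j l Q lr cQ QK.
apply: le_trans (ltW (hr j)); apply: ereal_sup_ubound; right; exists Q => //.
by split => //; exists l.
Unshelve. all: by end_near. Qed.

Lemma ess_bounded :
  (ess_sup mu (fun z => (vnorm (F z))%:E) < +oo)%E ->
  exists2 B : R, 0 <= B & lebesgue_outer [set z | ~ (vnorm (F z) <= B)] = 0%E.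
Proof.
set s := ess_sup _ _ => soo.
have hs : {ae mu, forall z : Rn R (q + q), ((vnorm (F z))%:E <= s)%E}.
  exact: ess_sup_ge.
exists (Num.max 0 (fine s)); first by rewrite le_max lexx.
apply: negligible_outer; apply: negligibleS hs => z /= hz hs; apply: hz.
rewrite le_max; apply/orP; right.
by move: soo hs; case: s => [s| |] //=; rewrite lee_fin.
Qed.

Lemma zak_shift (D : 'rV[int]_(q + q)) :
  lebesgue_outer [set z | ~ (F (z + map_mx intr D) =
    expi (2 * pi * \sum_(k < q) (D 0 (lshift q k))%:~R * z 0 (rshift q k)) *: F z)] = 0%E.
Proof.
have [_ /(_ (lsubmx D) (rsubmx D)) h] := Fzak.
apply: negligible_outer; apply: negligibleS h => z /= hz h; apply: hz.
have -> : z + map_mx intr D = row_mx (lsubmx z + map_mx intr (lsubmx D))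
    (rsubmx z + map_mx intr (rsubmx D)).
  by rewrite -[LHS]hsubmxK; congr row_mx; apply/matrixP => i j; rewrite !mxE.
rewrite h hsubmxK; congr (expi (_ * _) *: _).
by apply: eq_bigr => k _; rewrite !mxE.
Qed.

Lemma vnorm_large (w : 'rV[R[i]]_M) (c : R) : (0 < M)%N -> 0 < c -> c <= vnorm w ->
  exists j, c / M%:R <= normc (w 0 j).
Proof.
move=> M0 c0 cw; apply: contrapT => h.
have M0' : 0 < M%:R :> R by rewrite ltr0n.
(* If all components were below [c / M], the sum of squares would be below M (c / M)^2, which is at
   most c^2. *)
have : \sum_(j < M) normc (w 0 j) ^+ 2 < c ^+ 2.
  apply: (@lt_le_trans _ _ (\sum_(j < M) (c / M%:R) ^+ 2)).
    apply: ltr_sum; first by apply/hasP; exists (Ordinal M0) => //; rewrite mem_index_enum.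
    move=> j _; rewrite ltrXn2r// ?normc_ge0//.
    by rewrite ltNge; apply/negP => hj; apply: h; exists j.
  rewrite sumr_const card_ord -[X in _ <= X]mulr1 exprMn -mulrnAr ler_pM2l ?exprn_gt0//.
  rewrite -mulr_natl exprVn ler_pdivrMr ?exprn_gt0// mul1r.
  by rewrite -natrX ler_nat -[leqLHS]muln1 leq_pmul2l.
apply/negP; rewrite -leNgt -[leRHS]sqr_sqrtr; last by apply: sumr_ge0 => j _; rewrite sqr_ge0.
by rewrite lerXn2r ?nnegrE ?sqrtr_ge0// ltW.
Qed.

End nonvanishing.

(** * Cube means as a discrete section *)

Section approximate_section.
Variables (R : realType) (q M p : nat) (F : 'rV[R]_(q + q) -> 'rV[R[i]]_M).
Hypothesis Fzak : zak_quasiperiodic F.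
Local Notation normc := Normc.normc.
Local Notation N := (p.+4%:R : R).
Local Notation T := 'rV['I_p.+4]_(q + q).
Local Notation n := (q + q)%N.

Definition corner (x : T) : 'rV[R]_n := \row_i ((x 0 i)%:R / N).

(* The cubes of two adjacent lattice points overlap in a set of positive
   relative measure. *)
Definition cell (x : T) : set 'rV[R]_n := box (corner x) (corner x + const_mx (2 / N)).

Definition cell_mean (j : 'I_M) (x : T) : R[i] := cmean (cell x) (fun z => F z 0 j).

Variables (c B eta : R).
Hypothesis M_gt0 : (0 < M)%N.
Hypothesis c_gt0 : 0 < c.
Hypothesis eta_gt0 : 0 < eta.
Hypothesis Flarge : lebesgue_outer
  [set z | ~ (box (const_mx 0) (const_mx 1) z -> c <= vnorm (F z))] = 0%E.
Hypothesis B_ge0 : 0 <= B.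
Hypothesis Fbounded : lebesgue_outer [set z | ~ (vnorm (F z) <= B)] = 0%E.
Hypothesis Fosc : forall x j, (osc (cell x) (fun z => F z 0%R j) <=
  (eta / (3 * M%:R * 2 ^+ (q + q)))%:E)%E.
Hypothesis N_large : 8 * pi * B / N <= eta.

Definition bad (x : T) : set 'rV[R]_n :=
  cell x `&` [set z | exists j, eta <= normc (F z 0 j - cell_mean j x)].

Let N_gt0 : 0 < N. Proof. by rewrite ltr0n. Qed.
Let v := N^-1 ^+ (q + q).
Let v_gt0 : 0 < v. Proof. by rewrite exprn_gt0// invr_gt0. Qed.

(** Markov gives at most [v / (3 * M)] for each component: the factor [2 ^+ (q + q)] in [Fosc] is
    the volume ratio of a cell, of side 2 / N, to a cube of side 1 / N. *)
Lemma bad_small x : (lebesgue_outer (bad x) <= (v / 3)%:E)%E.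
Proof.
apply: le_trans (@outer_measure_exists_fin R n M _
  (fun j z => eta <= normc (F z 0 j - cell_mean j x)) (v / (3 * M%:R)) _) _.
  move=> j; apply: le_trans (osc_markov _ eta_gt0 _ (Fosc x j)) _.
  - by rewrite divr_gt0.
  - by have [+ _] := Fzak; apply.
  rewrite lee_fin le_eqVlt; apply/orP; left; apply/eqP.
  rewrite exprMn -/v; field.
  by rewrite !gt_eqF ?exprn_gt0 ?ltr0n.
rewrite lee_fin le_eqVlt; apply/orP; left; apply/eqP; field.
by rewrite gt_eqF ?ltr0n.
Qed.

Lemma not_bad x z j : cell x z -> ~ bad x z -> normc (F z 0 j - cell_mean j x) < eta.
Proof. by move=> xz nb; rewrite ltNge; apply/negP => h; apply: nb; split=> //; exists j. Qed.

Lemma normc_le_vnorm (w : 'rV[R[i]]_M) j : normc (w 0 j) <= vnorm w.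
Proof.
rewrite -[leLHS]ger0_norm ?normc_ge0// -sqrtr_sqr ler_wsqrtr// (bigD1 j)//=.
by rewrite lerDl; apply: sumr_ge0 => i _; rewrite sqr_ge0.
Qed.

Lemma cell_mean_large x : exists j, c / M%:R - eta <= normc (cell_mean j x).
Proof.
have Ni : 0 <= N^-1 by rewrite invr_ge0.
have h0 : (lebesgue_outer (set0 : set 'rV[R]_n) <= (v / 3)%:E)%E.
  by rewrite outer_measure0 lee_fin divr_ge0// ltW.
(* The cube of side 1 / N at the corner stays in the unit box, where [F] is large; a cell at the
   last lattice point sticks out of it. *)
have [z []] := avoid_small_sets v_gt0 (cube_volume (corner x) Ni) (bad_small x) h0 Flarge.
move=> zW zb _ /contrapT zF.
have z01 : box (const_mx 0) (const_mx 1) z.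
  move=> i; have := zW i; rewrite !mxE => /andP[l u]; apply/andP; split.
    by apply: le_trans l; rewrite divr_ge0.
  apply: le_trans u _; rewrite -[X in _ + X]mul1r -mulrDl ler_pdivrMr// mul1r natr1 ler_nat.
  exact: ltn_ord.
have zx : cell x z.
  move=> i; have := zW i; rewrite !mxE => /andP[-> u] /=; apply: le_trans u _.
  by rewrite lerD2l -[leLHS]mul1r ler_pM2r ?invr_gt0// ler1n.
have [j hj] := vnorm_large M_gt0 c_gt0 (zF z01); exists j.
have := not_bad j zx zb; rewrite -normcN opprB => h.
have := le_normcD (cell_mean j x) (F z 0 j - cell_mean j x).
rewrite addrC subrK => h2; have := not_bad j zx zb; lra.
Qed.

(** The integer vector lost when the edge wraps around: adding it to the corner of the neighbour
    restores the true adjacent position. *)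
Definition wrap (x : T) a : 'rV[int]_n := if x 0 a == ord_max then delta_mx 0 a else 0.

Lemma corner_unitv x a i :
  corner (x + unitv p a) 0 i + map_mx intr (wrap x a) 0 i = corner x 0 i + (i == a)%:R / N.
Proof.
rewrite [X in X + _]mxE [X in _ + X = _]mxE [X in _ = X + _]mxE /wrap.
have [->|ia] := eqVneq i a; last first.
  rewrite unitv_ne 1?eq_sym// mul0r; congr (_ + _).
  by case: eqP => _; rewrite mxE ?(negbTE ia) ?andbF.
rewrite unitv_eq mul1r; case: eqP => [->|/eqP xm].
  rewrite mxE !eqxx /= modnn mul0r add0r -[X in _ + X]mul1r -mulrDl natr1 divff//.
rewrite mxE addr0 modn_small; first by rewrite -natr1 mulrDl mul1r.
have := ltn_ord (x 0 a); rewrite leq_eqVlt => /predU1P[h|//].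
by move: xm; rewrite -val_eqE /= -eqSS h eqxx.
Qed.

Lemma cell_mean_near j x a :
  normc (expi (transition R x a) * cell_mean j (x + unitv p a) - cell_mean j x)
  <= 3 * eta.
Proof.
set y := x + unitv p a; set t := transition R x a; set D := wrap x a.
pose delta : 'rV[R]_n := map_mx intr D.
(* Moved by [delta], the cube of side 1 / N at [W0] is the subcube of the cell of [x] farthest from
   its corner. It also lies in the cell of [y] moved by [delta]. *)
pose W0 := corner x + const_mx N^-1 - delta.
have Z0 : lebesgue_outer ([set z | ~ (F (z + delta) =
    expi (2 * pi * \sum_(k < q) (D 0 (lshift q k))%:~R * z 0 (rshift q k)) *: F z)]
    `|` [set z | ~ (vnorm (F z) <= B)]) = 0%E.
  apply/eqP; rewrite eq_le outer_measure_ge0 andbT.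
  by apply: le_trans (outer_measureU2 _ _ _) _; rewrite /= zak_shift// Fbounded adde0.
have sx : (lebesgue_outer [set z | bad x (z + delta)%R] <= (v / 3)%:E)%E.
  by rewrite lebesgue_outer_shift bad_small.
have Ni : 0 <= N^-1 by rewrite invr_ge0.
have [z []] := avoid_small_sets v_gt0 (cube_volume W0 Ni) (bad_small y) sx Z0.
move=> zW zy zx zZ.
have zF : F (z + delta) =
    expi (2 * pi * \sum_(k < q) (D 0 (lshift q k))%:~R * z 0 (rshift q k)) *: F z.
  by apply: contrapT => h; apply: zZ; left.
have zB : vnorm (F z) <= B by apply: contrapT => h; apply: zZ; right.
have zcx : cell x (z + delta).
  move=> i; have := zW i; rewrite /W0 /delta !mxE => /andP[l u].
  have : N^-1 <= 2 / N by rewrite -[leLHS]mul1r ler_pM2r ?invr_gt0// ler1n.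
  have : 0 <= N^-1 by rewrite invr_ge0.
  move: l u; set X := (_ / N); move: X ((D 0 i)%:~R : R) (N^-1) => X d s l u s0 s2.
  by apply/andP; split; lra.
have zcy : cell y z.
  move=> i; have := zW i; have := corner_unitv x a i; rewrite -/y -/D.
  rewrite [X in _ -> _ -> _ <= _ <= X]mxE [const_mx (2 / N) 0 i]mxE.
  move: (corner y 0 i) => Y; rewrite /W0 /delta !mxE.
  have : 0 <= (i == a)%:R / N <= N^-1.
    by case: (i == a); rewrite ?mul1r ?mul0r lexx invr_ge0 ltW.
  set X := ((x 0 i)%:R / N); set w := (_ / N).
  move: X w ((D 0 i)%:~R : R) (N^-1) => X w d s /andP[s0 s2] E /andP[l u].
  by apply/andP; split; lra.
set th := 2 * pi * _ in zF.
(* [transition] reads v_k at the corner, quasiperiodicity reads it at [z]; these differ by at most 2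
   / N. Without a wrap in some u_k both angles are 0. *)
have tth : `|t - th| <= 4 * pi / N.
  rewrite /t /th /transition; case: (split_ordP a) => k ak; last first.
    rewrite big1 ?mulr0 ?subr0 ?normr0 ?divr_ge0 ?mulr_ge0 ?pi_ge0// => k' _.
    by rewrite /D /wrap ak; case: eqP => _; rewrite mxE ?mul0r// eq_lrshift andbF mul0r.
  case: ifPn => xm; last first.
    rewrite big1 ?mulr0 ?subr0 ?normr0 ?divr_ge0 ?mulr_ge0 ?pi_ge0// => k' _.
    by rewrite /D /wrap (negbTE xm) mxE mul0r.
  have DE : D = delta_mx 0 (lshift q k) by rewrite /D /wrap xm ak.
  rewrite (bigD1 k)//= big1 => [|k' kk']; last first.
    by rewrite DE mxE eq_lshift (negbTE kk') andbF mul0r.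
  have := zcx (rshift q k); rewrite /delta DE !mxE !eqxx eq_rlshift /= addr0 mul1r addr0.
  move=> /andP[l u]; rewrite -mulrBr normrM ger0_norm ?mulr_ge0 ?pi_ge0//.
  have : `|(x 0 (rshift q k))%:R / N - z 0 (rshift q k)| <= 2 / N.
    rewrite ler_norml; move: l u; set X := (_ / N).
    have : 0 <= N^-1 by [].
    by move: X (N^-1) => X s s0 l u; apply/andP; split; lra.
  move=> /(ler_wpM2l (_ : 0 <= 2 * pi)) h; apply: le_trans (h _) _.
    by rewrite mulr_ge0 ?pi_ge0.
  by rewrite le_eqVlt; apply/orP; left; apply/eqP; field; rewrite gt_eqF.
(* Three errors of at most [eta]: two deviations from a mean, and a phase error of at most 2 (4 pi /
   N) times the bound [B]. *)
have E : expi t * cell_mean j y - cell_mean j x =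
  expi t * (cell_mean j y - F z 0 j) + ((expi t - expi th) * F z 0 j +
  (F (z + delta) 0 j - cell_mean j x)) by rewrite zF mxE; ring.
rewrite E; apply: le_trans (le_normcD _ _) _.
have h1 : normc (expi t * (cell_mean j y - F z 0 j)) <= eta.
  by rewrite Normc.normcM normc_expi mul1r -normcN opprB ltW// not_bad.
have h2 : normc (F (z + delta) 0 j - cell_mean j x) <= eta by rewrite ltW// not_bad.
have h3 : normc ((expi t - expi th) * F z 0 j) <= eta.
  rewrite Normc.normcM; apply: le_trans N_large.
  have -> : 8 * pi * B / N = (2 * (4 * pi / N)) * B by ring.
  apply: ler_pM; rewrite ?normc_ge0//.
    by apply: le_trans (expi_lipschitz _ _) _; rewrite ler_pM2l.
  exact: le_trans (normc_le_vnorm _ _) zB.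
by have := le_normcD ((expi t - expi th) * F z 0 j) (F (z + delta) 0 j - cell_mean j x); lra.
Qed.

End approximate_section.

Lemma vmo_section_not_bounded_below (R : realType) (q M : nat)
    (F : 'rV[R]_(q + q) -> 'rV[R[i]]_M) (c : R) :
  (0 < M)%N -> (M <= q)%N -> 0 < c ->
  (ess_sup (@lebesgueRn R (q + q)) (fun z => (vnorm (F z))%:E) < +oo)%E ->
  zak_quasiperiodic F ->
  (exists U : set 'rV[R]_(q + q),
    [/\ open U, box (const_mx (-2)) (const_mx 3) `<=` U
       & forall j : 'I_M, locally_VMO U (fun z => F z 0 j)]) ->
  lebesgue_outer [set z | ~ (box (const_mx 0) (const_mx 1) z -> c <= vnorm (F z))] <> 0%E.
Proof.
move=> M0 Mq c0 Fb Fz Fvmo Fc.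
have [B B0 FB] := ess_bounded Fb.
have M0' : 0 < M%:R :> R by rewrite ltr0n.
(* Chosen so that [(2 * q + 2) * (3 * eta) = c / M - eta], the smallness condition of
   [no_discrete_section] for means varying by [3 * eta]. *)
pose eta := c / (M%:R * (6 * q + 7)%:R).
have eta0 : 0 < eta by rewrite divr_gt0// mulr_gt0// ltr0n addn_gt0 orbT.
pose eps := eta / (3 * M%:R * 2 ^+ (q + q)).
have eps0 : 0 < eps by rewrite divr_gt0// !mulr_gt0// exprn_gt0.
have [r r0 hr] := osc_small eps0 Fvmo.
(* The first summand makes the cell side at most [r], the second makes the phase error at most
   [eta]. *)
pose p := Num.bound (2 / r + 8 * pi * B / eta).
have pi0 : 0 <= 8 * pi * B by rewrite !mulr_ge0// pi_ge0.
have Np : 2 / r + 8 * pi * B / eta <= p.+4%:R.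
  apply: (@le_trans _ _ p%:R); last by rewrite ler_nat; lia.
  by apply/ltW/archi_boundP; rewrite addr_ge0// divr_ge0// ltW.
have N0 : 0 < p.+4%:R :> R by rewrite ltr0n.
have Nr : 2 / p.+4%:R <= r.
  rewrite ler_pdivrMr// mulrC -ler_pdivrMr//; apply: le_trans Np.
  by rewrite lerDl divr_ge0// ltW.
have NB : 8 * pi * B / p.+4%:R <= eta.
  rewrite ler_pdivrMr// -ler_pdivrMl// mulrC; apply: le_trans Np.
  by rewrite lerDr divr_ge0// ltW.
have Fosc (x : 'rV['I_p.+4]_(q + q)) (j : 'I_M) :
    (osc (@cell R q p x) (fun z => F z 0%R j) <= eps%:E)%E.
  apply: hr Nr _ _; first by split; [rewrite divr_gt0|exists (@corner R q p x)].
  move=> z zx i; have := zx i; rewrite !mxE => /andP[l u]; apply/andP; split.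
    by apply: le_trans l; apply: (@le_trans _ _ 0); rewrite ?oppr_le0// divr_ge0.
  apply: le_trans u _; rewrite -mulrDl ler_pdivrMr// -natrD -natrM ler_nat.
  by have := ltn_ord (x 0 i); lia.
(* The [M] components are padded with zeros to [q]; at each point only one has to be large. *)
pose m (j : 'I_q) (x : 'rV['I_p.+4]_(q + q)) : R[i] :=
  if insub (j : nat) is Some j' then cell_mean F j' x else 0.
apply: (@no_discrete_section R q p m (3 * eta) (c / M%:R - eta)).
- by rewrite mulr_gt0.
- move=> x; have [j hj] := cell_mean_large Fz M0 c0 eta0 Fc Fosc x.
  by exists (widen_ord Mq j); rewrite /m valK.
- move=> j x a; rewrite /m; case: insub => [j'|].
    exact: (cell_mean_near Fz M0 eta0 FB Fosc NB).
  by rewrite mulr0 subr0 Normc.normc0 mulr_ge0// ltW.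
rewrite lerBrDr /eta le_eqVlt; apply/orP; left; apply/eqP.
rewrite !(natrD, natrM); field.
by rewrite !gt_eqF// -natrM -natrD ltr0n addn_gt0 orbT.
Qed.

Lemma vmo_ess_inf0 (R : realType) (q M : nat) (F : 'rV[R]_(q + q) -> 'rV[R[i]]_M) :
  (0 < M)%N -> (M <= q)%N ->
  (ess_sup (@lebesgueRn R (q + q)) (fun z => (vnorm (F z))%:E) < +oo)%E ->
  zak_quasiperiodic F ->
  (exists U : set 'rV[R]_(q + q),
    [/\ open U, box (const_mx (-2)) (const_mx 3) `<=` U
       & forall j : 'I_M, locally_VMO U (fun z => F z 0 j)]) ->
  ess_inf_on (box (const_mx 0) (const_mx 1)) (fun z => vnorm (F z)) = 0%E.
Proof.
move=> M0 Mq Fb Fz Fvmo; apply/eqP; rewrite eq_le; apply/andP; split; last first.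
  apply: ereal_sup_ubound => /=; apply: aeW => z _.
  by rewrite lee_fin sqrtr_ge0.
apply: ge_ereal_sup => y /= hy; rewrite leNgt; apply/negP => y0.
(* [y] may be infinite, so a positive real below it is used. *)
have [c c0 cy] : exists2 c : R, 0 < c & (c%:E <= y)%E.
  case: y y0 {hy} => [c| |] //; first by rewrite lte_fin => c0; exists c.
  by move=> _; exists 1; rewrite ?leey.
apply: (vmo_section_not_bounded_below M0 Mq c0 Fb Fz Fvmo).
apply: negligible_outer; apply: negligibleS hy => z /= hz h; apply: hz => zb.
by have := le_trans cy (h zb); rewrite lee_fin.
Qed.

(** * Smooth sections without common zero *)

Section continuous_measurable.
Variable R : realType.

(** The rational boxes inside an open set are countably many and cover it. *)
Lemma measurable_open n (U : set 'rV[R]_n) : open U -> measurable (U : set (Rn R n)).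
Proof.
move=> oU.
pose I := ('rV[rat]_n * 'rV[rat]_n)%type.
pose r (a : 'rV[rat]_n) : 'rV[R]_n := map_mx ratr a.
pose G (ab : I) : set (Rn R n) :=
  if pselect (box (r ab.1) (r ab.2) `<=` U) then box (r ab.1) (r ab.2) else set0.
have -> : (U : set (Rn R n)) = \bigcup_ab G ab.
  apply/seteqP; split => x; last first.
    by case=> ab _; rewrite /G; case: pselect => //= h /h.
  move=> Ux; have : nbhs x U by exact: open_nbhs_nbhs.
  rewrite -nbhs_ballE => -[e /= e0 xeU].
  have lo i : exists a : rat, x 0 i - e < ratr a < x 0 i.
    have [a] := @rat_in_itvoo R (x 0 i - e) (x 0 i) ltac:(rewrite ltrBlDr ltrDl//).
    by rewrite in_itv/= => ?; exists a.
  have hi i : exists a : rat, x 0 i < ratr a < x 0 i + e.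
    have [a] := @rat_in_itvoo R (x 0 i) (x 0 i + e) ltac:(rewrite ltrDl//).
    by rewrite in_itv/= => ?; exists a.
  have [a ha] := choice lo; have [b hb] := choice hi.
  exists (\row_i a i, \row_i b i) => //; rewrite /G /=.
  case: pselect => [_ i|h]; first by have := ha i; have := hb i; rewrite !mxE; lra.
  exfalso; apply: h => y yab; apply: xeU; split => // i j.
  rewrite ord1 /ball/= ltr_distl.
  by have := yab j; have := ha j; have := hb j; rewrite !mxE; lra.
apply: countable_bigcupT_measurable; first exact: countableP.
by move=> ab; rewrite /G; case: pselect => h; [exact: measurable_box|exact: measurable0].
Qed.

Lemma measurable_continuous n (f : 'rV[R]_n -> R) :
  continuous f -> measurable_fun [set: Rn R n] (f : Rn R n -> R).
Proof.
move=> cf; apply: (measurability _ (measurable_realfun.RGenOInfty.measurableE R)).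
move=> _ [_ [c ->] <-]; rewrite setTI; apply: measurable_open.
by move/continuousP : cf; apply; rewrite set_itvE; exact: open_gt.
Qed.

End continuous_measurable.

(** * Closure properties of C^k functions *)

Section Ck_calculus.
Variables (R : realType) (n : nat).
Implicit Types (f g : 'rV[R]_n -> R).

Let contD f g : continuous f -> continuous g -> continuous (fun x => f x + g x).
Proof. by move=> cf cg x; exact: (continuousD (cf x) (cg x)). Qed.

Let contM f g : continuous f -> continuous g -> continuous (fun x => f x * g x).
Proof. by move=> cf cg x; exact: (continuousM (cf x) (cg x)). Qed.

Let cont_near f g x : (\forall y \near x, f y = g y) ->
  {for x, continuous g} -> {for x, continuous f}.
Proof.
move=> fg cg; have fgx := nbhs_singleton fg.
rewrite /prop_for /continuous_at fgx; apply: cvg_trans cg.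
apply: (@near_eq_cvg _ _ (nbhs x) (nbhs_filter x) g f); move: fg.
by apply: filterS => y fgy; exact: esym fgy.
Qed.

Lemma Ck_intro k f (df : 'I_n -> 'rV[R]_n -> R) : continuous f ->
  (forall i x, is_derive x (delta_mx 0 i : 'rV[R]_n) f (df i x)) ->
  (forall i, Ck k (df i)) -> Ck k.+1 f.
Proof.
move=> cf fdf Cdf; split=> // i; split=> [x|]; first by have [] := fdf i x.
rewrite (_ : (fun x => _) = df i); first exact: Cdf.
by apply/funext => x; have [] := fdf i x.
Qed.

Lemma Ck_elim k f : Ck k.+1 f -> exists df : 'I_n -> 'rV[R]_n -> R,
  (forall i x, is_derive x (delta_mx 0 i : 'rV[R]_n) f (df i x)) /\
  (forall i, Ck k (df i)).
Proof.
move=> [cf h]; exists (fun i => 'D_(delta_mx 0 i : 'rV[R]_n) f); split=> i.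
  by move=> x; have [d _] := h i; apply: DeriveDef.
by have [] := h i.
Qed.

Lemma Ck_continuous k f : Ck k f -> continuous f.
Proof. by case: k => [|k] []. Qed.

Lemma Ck_pred k f : Ck k.+1 f -> Ck k f.
Proof.
elim: k f => [|k IH] f; first by move=> [].
move=> h; have [df [fdf Cdf]] := Ck_elim h.
by apply: (@Ck_intro k f df) => //; [exact: Ck_continuous h|move=> i; apply: IH].
Qed.

Lemma Ck_cst k (c : R) : Ck k (fun _ : 'rV[R]_n => c).
Proof.
elim: k c => [|k IH] c; first by split=> //; exact: cst_continuous.
apply: (@Ck_intro _ _ (fun _ _ => 0)) => //; first exact: cst_continuous.
Qed.

Lemma CkD k f g : Ck k f -> Ck k g -> Ck k (fun x => f x + g x).
Proof.
elim: k f g => [|k IH] f g hf hg.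
  by split=> //; exact: (contD (Ck_continuous hf) (Ck_continuous hg)).
have [df [fdf Cdf]] := Ck_elim hf; have [dg [gdg Cdg]] := Ck_elim hg.
apply: (@Ck_intro _ _ (fun i x => df i x + dg i x)).
- exact: (contD (Ck_continuous hf) (Ck_continuous hg)).
- by move=> i; exact: IH (Cdf i) (Cdg i).
Qed.

Lemma CkM k f g : Ck k f -> Ck k g -> Ck k (fun x => f x * g x).
Proof.
elim: k f g => [|k IH] f g hf hg.
  by split=> //; exact: (contM (Ck_continuous hf) (Ck_continuous hg)).
have [df [fdf Cdf]] := Ck_elim hf; have [dg [gdg Cdg]] := Ck_elim hg.
apply: (@Ck_intro _ _ (fun i x => f x * dg i x + g x * df i x)).
- exact: (contM (Ck_continuous hf) (Ck_continuous hg)).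
- move=> i; exact: CkD (IH _ _ (Ck_pred hf) (Cdg i)) (IH _ _ (Ck_pred hg) (Cdf i)).
Qed.

Lemma Ck_local k f :
  (forall x : 'rV[R]_n, exists2 g, Ck k g & \forall y \near x, f y = g y) -> Ck k f.
Proof.
elim: k f => [|k IH] f h.
  by split=> // x; have [g [cg _] fg] := h x; exact: cont_near fg (cg x).
have loc (i : 'I_n) (x : 'rV[R]_n) : exists g dg, [/\
    Ck k.+1 g, \forall y \near x, f y = g y,
    forall y, is_derive y (delta_mx 0 i : 'rV[R]_n) g (dg y) & Ck k dg].
  have [g Cg fg] := h x; have [dg [gdg Cdg]] := Ck_elim Cg.
  by exists g, (dg i).
have ei (i : 'I_n) : (delta_mx 0 i : 'rV[R]_n) != 0.
  by apply/eqP => /rowP/(_ i); rewrite !mxE !eqxx => /eqP; rewrite oner_eq0.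
have fd (i : 'I_n) (x : 'rV[R]_n) (g : 'rV[R]_n -> R) (dg : R) :
    (\forall y \near x, f y = g y) ->
    is_derive x (delta_mx 0 i : 'rV[R]_n) g dg ->
    is_derive x (delta_mx 0 i : 'rV[R]_n) f dg.
  move=> fg; apply: near_eq_is_derive => //.
  by apply: filterS fg => y ->.
apply: (@Ck_intro _ _ (fun i => 'D_(delta_mx 0 i : 'rV[R]_n) f)).
- by move=> x; have [g Cg fg] := h x; apply: cont_near fg _; exact: (Ck_continuous Cg).
- move=> i x; have [g [dg [_ fg gdg _]]] := loc i x.
  by have [d _] := fd i x g _ fg (gdg x); apply: DeriveDef.
move=> i; apply: IH => x; have [g [dg [_ fg gdg Cdg]]] := loc i x.
(* Agreement near [x] is agreement near every point close to [x], so the derivatives agree near [x]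
   too. *)
exists dg => //; have /nbhs_interior := fg; apply: filterS => y fgy.
by have [_ ->] := fd i y g _ fgy (gdg y).
Qed.

Lemma is_derive_coord (h : R -> R) (dh : R) (i j : 'I_n) (x : 'rV[R]_n) :
  is_derive (x 0 i) (1 : R) h dh ->
  is_derive x (delta_mx 0 j : 'rV[R]_n) (fun z => h (z 0 i)) (dh * (i == j)%:R).
Proof.
have [->|ij] := eqVneq i j; last first.
  move=> _; rewrite mulr0.
  have E : (fun t : R => t^-1 *: (((fun z : 'rV[R]_n => h (z 0 i)) \o shift x)
      (t *: delta_mx 0 j) - h (x 0 i))) = (fun=> 0).
    by apply/funext => t; rewrite /= !mxE (negbTE ij) mulr0 add0r subrr scaler0.
  apply: DeriveDef; rewrite /derivable /derive E; first exact: is_cvg_cst.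
  exact: lim_cst.
move=> [hd hE]; rewrite mulr1.
have E : (fun t : R => t^-1 *: (((fun z : 'rV[R]_n => h (z 0 j)) \o shift x)
      (t *: delta_mx 0 j) - h (x 0 j)))
    = (fun t : R => t^-1 *: ((h \o shift (x 0 j)) (t *: 1) - h (x 0 j))).
  by apply/funext => t; rewrite /= !mxE !eqxx.
by apply: DeriveDef; rewrite /derivable /derive E.
Qed.

End Ck_calculus.

Section bump.
Variable R : realType.

(** The derivative of a member of this family is a combination of two others, so smoothness of the
    classical flat function [flat 0] follows by induction. *)
Definition flat (n : nat) (x : R) : R :=
  if 0 < x then x^-1 ^+ n * expR (- x^-1) else 0.

Lemma flat_ge0 n x : 0 <= flat n x.
Proof.
rewrite /flat; case: ifP => // x0.
by rewrite mulr_ge0 ?expR_ge0// exprn_ge0// invr_ge0 ltW.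
Qed.

Lemma flat_le n (x : R) : 0 < x -> flat n x <= (n.+2)`!%:R * x ^+ 2.
Proof.
move=> x0; rewrite /flat x0 expRN.
have h : x^-1 ^+ n.+2 / (n.+2)`!%:R <= expR x^-1.
  have := @expR_ge1Dxn R x^-1 n.+1; rewrite invr_ge0 (ltW x0) => /(_ isT); lra.
have fact0 : 0 < (n.+2)`!%:R :> R by rewrite ltr0n fact_gt0.
rewrite ler_pdivrMr ?expR_gt0//.
apply: (@le_trans _ _ ((n.+2)`!%:R * x ^+ 2 * (x^-1 ^+ n.+2 / (n.+2)`!%:R))).
  rewrite le_eqVlt; apply/orP; left; apply/eqP.
  have -> : x^-1 ^+ n.+2 = x^-1 ^+ 2 * x^-1 ^+ n by rewrite -exprD.
  by field; rewrite !gt_eqF.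
by rewrite ler_wpM2l// mulr_ge0 ?exprn_ge0 ?ltW.
Qed.

Lemma is_derive_flat n (x : R) :
  is_derive x 1 (flat n) (flat n.+2 x - n%:R * flat n.+1 x).
Proof.
have [x0|x0|->] := ltgtP x 0.
- rewrite /flat ltNge (ltW x0)/= mulr0 subr0.
  apply: (@near_eq_is_derive _ _ _ (cst 0)).
  near=> y; rewrite ltNge; suff -> : y <= 0 by [].
  by apply: ltW; near: y; exact: lt_nbhsl.
- have xn : x != 0 by rewrite gt_eqF.
  apply: (@near_eq_is_derive _ _ _ (fun y : R => y^-1 ^+ n * expR (- y^-1))).
    near=> y; rewrite /flat; suff -> : 0 < y by [].
    by near: y; exact: lt_nbhsr.
  have dV : is_derive x 1 (fun y : R => y^-1) (- x ^- 2).
    by have := is_deriveV xn (is_derive_id x (1 : R)); rewrite /= scaler1.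
  have dX : is_derive x 1 (fun y : R => y^-1 ^+ n) ((n%:R * x^-1 ^+ n.-1) * (- x ^- 2)).
    by have := @is_deriveX _ _ _ n _ _ _ dV; rewrite exprfctE.
  have dE : is_derive x 1 (fun y : R => expR (- y^-1)) (expR (- x^-1) * x ^- 2).
    have := @is_derive1_comp R expR (fun y : R => - y^-1) x _ _ (is_derive_expR _) (is_deriveN dV).
    by rewrite opprK.
  have := is_deriveM dX dE; set d := (X in is_derive _ _ _ X -> _).
  suff -> : d = flat n.+2 x - n%:R * flat n.+1 x by [].
  rewrite /d /flat x0; case: (n) => [|m]; rewrite /GRing.scale/=.
    by rewrite !expr0 !mul0r !mul1r mulr0 addr0 subr0 -exprVn mulrC.
  rewrite -[m.+3]addn3 -[m.+2]addn2 -[m.+1]addn1 !exprD.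
  by field.
rewrite /flat ltxx mulr0 subr0.
(* At 0 the difference quotient is at most (n + 2)! h for positive h by [flat_le], and it is 0 for
   negative h. *)
suff H : (fun h : R => h^-1 *: ((flat n \o shift 0) (h *: 1) - flat n 0)) @ 0^' --> (0 : R).
  by apply: DeriveDef; [apply/cvg_ex; exists 0|exact/cvg_lim].
apply/cvgr0Pnorm_le => eps eps0; near=> h.
rewrite /= addr0 [h *: 1]mulr1 [flat n 0]/flat ltxx subr0 /GRing.scale/=.
have h0 : h != 0 by near: h; exact: nbhs_dnbhs_neq.
have [hp|hn] := ltP 0 h; last by rewrite /flat ltNge hn mulr0 normr0 ltW.
rewrite ger0_norm ?mulr_ge0 ?flat_ge0 ?invr_ge0 ?(ltW hp)//.
rewrite ler_pdivrMl//; apply: le_trans (flat_le n hp) _.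
rewrite expr2 mulrA mulrAC -[leRHS]mulrC ler_pM2r// .
have fact0 : 0 < (n.+2)`!%:R :> R by rewrite ltr0n fact_gt0.
rewrite -ler_pdivlMl//; apply: le_trans (ler_norm _) _.
near: h; apply: dnbhs0_le; by rewrite mulr_gt0// invr_gt0.
Unshelve. all: by end_near. Qed.

End bump.

Section smooth_building_blocks.
Variables (R : realType) (n : nat).
Implicit Types (i : 'I_n).

Lemma is_derive_affine (h : R -> R) (dh s c t : R) :
  is_derive (s * t + c) 1 h dh -> is_derive t 1 (fun t => h (s * t + c)) (dh * s).
Proof.
move=> hd; apply: (@is_derive1_comp R h (fun t => s * t + c)) => //.
have := is_deriveD (is_deriveZ s (is_derive_id t (1 : R))) (is_derive_cst c t (1 : R)).
by rewrite addr0 [s *: 1]mulr1.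
Qed.

Lemma continuous_coord (h dh : R -> R) i :
  (forall t : R, is_derive t 1 h (dh t)) -> continuous (fun z : 'rV[R]_n => h (z 0 i)).
Proof.
move=> hd z; apply: (@continuous_comp _ _ _ (fun z : 'rV[R]_n => z 0 i) h).
  exact: coord_continuous.
by apply/differentiable_continuous/derivable1_diffP; have [] := hd (z 0 i).
Qed.

Lemma Ck_flat k m i (s c : R) : Ck k (fun z : 'rV[R]_n => flat m (s * z 0 i + c)).
Proof.
pose dh m t := (flat m.+2 (s * t + c) - m%:R * flat m.+1 (s * t + c)) * s.
have hd m' (t : R) : is_derive t 1 (fun t => flat m' (s * t + c)) (dh m' t).
  by apply: is_derive_affine; exact: is_derive_flat.
have cont m' : continuous (fun z : 'rV[R]_n => flat m' (s * z 0 i + c)).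
  exact: (@continuous_coord (fun t => flat m' (s * t + c)) (dh m') i (hd m')).
elim: k m => [|k IH] m; first by split.
apply: (@Ck_intro _ _ _ _ (fun j z => dh m (z 0 i) * (i == j)%:R)) => //.
  by move=> j x; exact: is_derive_coord.
move=> j; apply: CkM; last exact: Ck_cst.
apply: CkM; last exact: Ck_cst.
apply: (CkD (IH _)).
have -> : (fun z : 'rV[R]_n => - (m%:R * flat m.+1 (s * z 0 i + c))) =
  (fun z => - m%:R * flat m.+1 (s * z 0 i + c)) by apply/funext => z; rewrite mulNr.
by apply: CkM (IH _); exact: Ck_cst.
Qed.

Lemma Ck_coord k i : Ck k (fun z : 'rV[R]_n => z 0 i).
Proof.
have cont : continuous (fun z : 'rV[R]_n => z 0 i) by move=> z; exact: coord_continuous.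
case: k => [|k]; first by split.
apply: (@Ck_intro _ _ _ _ (fun j z => 1 * (i == j)%:R)) => //.
  by move=> j x; apply: (@is_derive_coord _ _ id).
by move=> j; exact: Ck_cst.
Qed.

Lemma Ck_trig k i (w : R) :
  Ck k (fun z : 'rV[R]_n => cos (w * z 0 i)) /\ Ck k (fun z : 'rV[R]_n => sin (w * z 0 i)).
Proof.
have hc (t : R) : is_derive t 1 (fun t => cos (w * t)) (- sin (w * t) * w).
  have := @is_derive_affine cos (- sin (w * t + 0)) w 0 t.
  under [X in is_derive t 1 X]eq_fun do rewrite addr0.
  by rewrite addr0; apply; exact: is_derive_cos.
have hs (t : R) : is_derive t 1 (fun t => sin (w * t)) (cos (w * t) * w).
  have := @is_derive_affine sin (cos (w * t + 0)) w 0 t.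
  under [X in is_derive t 1 X]eq_fun do rewrite addr0.
  by rewrite addr0; apply; exact: is_derive_sin.
have cc := @continuous_coord _ (fun t => - sin (w * t) * w) i hc.
have cs := @continuous_coord _ (fun t => cos (w * t) * w) i hs.
elim: k => [|k [IHc IHs]]; first by split; split.
split.
  apply: (@Ck_intro _ _ _ _ (fun j z => (- sin (w * z 0 i) * w) * (i == j)%:R)) => //.
    by move=> j x; apply: (@is_derive_coord _ _ (fun t => cos (w * t))); exact: hc.
  move=> j; apply: CkM; last exact: Ck_cst.
  apply: CkM; last exact: Ck_cst.
  have -> : (fun z : 'rV[R]_n => - sin (w * z 0 i)) = (fun z => -1 * sin (w * z 0 i)).
    by apply/funext => z; rewrite mulN1r.
  by apply: CkM IHs; exact: Ck_cst.
apply: (@Ck_intro _ _ _ _ (fun j z => (cos (w * z 0 i) * w) * (i == j)%:R)) => //.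
  by move=> j x; apply: (@is_derive_coord _ _ (fun t => sin (w * t))); exact: hs.
move=> j; apply: CkM; last exact: Ck_cst.
by apply: CkM IHc _; exact: Ck_cst.
Qed.

End smooth_building_blocks.

Section csmooth_calculus.
Variables (R : realType) (n : nat).
Implicit Types (H G : 'rV[R]_n -> R[i]).

Lemma csmooth_cst (w : R[i]) : csmooth (fun _ : 'rV[R]_n => w).
Proof. by split=> k; exact: Ck_cst. Qed.

Lemma csmoothD H G : csmooth H -> csmooth G -> csmooth (fun z => H z + G z).
Proof.
move=> [hr hi] [gr gi]; split=> k.
  have -> : (fun z => complex.Re (H z + G z)) = (fun z => complex.Re (H z) + complex.Re (G z)).
    by apply/funext => z; case: (H z) => ? ?; case: (G z).
  exact: CkD.
have -> : (fun z => complex.Im (H z + G z)) = (fun z => complex.Im (H z) + complex.Im (G z)).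
  by apply/funext => z; case: (H z) => ? ?; case: (G z).
exact: CkD.
Qed.

Lemma csmoothM H G : csmooth H -> csmooth G -> csmooth (fun z => H z * G z).
Proof.
move=> [hr hi] [gr gi]; split=> k.
  have -> : (fun z => complex.Re (H z * G z)) = (fun z => complex.Re (H z) * complex.Re (G z)
      + (-1 * complex.Im (H z)) * complex.Im (G z)).
    by apply/funext => z; case: (H z) => ? ?; case: (G z) => ? ? /=; rewrite mulN1r mulNr.
  apply: (CkD (CkM (hr k) (gr k))); apply: CkM (gi k); apply: CkM (hi k); exact: Ck_cst.
have -> : (fun z => complex.Im (H z * G z)) = (fun z => complex.Re (H z) * complex.Im (G z)
      + complex.Im (H z) * complex.Re (G z)).
  by apply/funext => z; case: (H z) => ? ?; case: (G z).
exact: CkD (CkM (hr k) (gi k)) (CkM (hi k) (gr k)).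
Qed.

Lemma csmooth_local H :
  (forall z : 'rV[R]_n, exists2 G, csmooth G & \forall y \near z, H y = G y) -> csmooth H.
Proof.
move=> h; split=> k; apply: Ck_local => z; have [G [Gr Gi] HG] := h z.
  by exists (fun z => complex.Re (G z)) => //; apply: filterS HG => y ->.
by exists (fun z => complex.Im (G z)) => //; apply: filterS HG => y ->.
Qed.

Lemma csmooth_cmeasurable H : csmooth H -> cmeasurable H.
Proof.
by move=> [hr hi]; split; apply: measurable_continuous;
  [exact: (Ck_continuous (hr 0%N))|exact: (Ck_continuous (hi 0%N))].
Qed.

End csmooth_calculus.

(** * Two quasiperiodic sections in the case q = 1 *)

Section zak_section.
Variable R : realType.
Implicit Types (u v x : R) (k : int).

Definition zbump x : R := flat 0 (1 * x + 1) * flat 0 (-1 * x + 1).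

Lemma zbump_gt0 x : -1 < x < 1 -> 0 < zbump x.
Proof.
move=> /andP[l r]; have h1 : 0 < 1 * x + 1 by lra.
have h2 : 0 < -1 * x + 1 by lra.
by rewrite /zbump /flat h1 h2 !expr0 !mul1r mulr_gt0 ?expR_gt0.
Qed.

Lemma zbump_eq0 x : x <= -1 \/ 1 <= x -> zbump x = 0.
Proof.
rewrite /zbump /flat => -[h|h].
  by rewrite ltNge (_ : 1 * x + 1 <= 0) ?mul0r//; lra.
by rewrite [X in _ * (if X then _ else _)]ltNge (_ : -1 * x + 1 <= 0) ?mulr0//; lra.
Qed.

(** For [b = true] the bump carries a factor [u - k], which tells overlapping translates apart. *)
Definition zterm (b : bool) k u v : R[i] :=
  ((u - k%:~R) ^+ b * zbump (u - k%:~R))%:C%C * expi (2 * pi * k%:~R * v).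

(* The factors e^(2 pi i k v) make the sum over all k of the k-th translates
   quasiperiodic; only two translates of the bump [zbump] meet a given u. *)
Definition zsec (b : bool) u v : R[i] :=
  zterm b (Num.floor u) u v + zterm b (Num.floor u + 1) u v.

Lemma zterm0 b k u v : u - k%:~R <= -1 \/ 1 <= u - k%:~R -> zterm b k u v = 0.
Proof. by move=> h; rewrite /zterm zbump_eq0// mulr0 mul0r. Qed.

(** The floor jumps at integers. Here the same three terms serve on both sides of [k], the
    additional one being zero, which gives smoothness there. *)
Lemma zsec_local b k u v : (k - 1)%:~R < u < (k + 1)%:~R ->
  zsec b u v = zterm b (k - 1) u v + zterm b k u v + zterm b (k + 1) u v.
Proof.
rewrite !intrD => /andP[l r]; have [ku|ku] := leP k%:~R u.
  have -> : zsec b u v = zterm b k u v + zterm b (k + 1) u v.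
    by rewrite /zsec (@floor_def _ _ k) // intrD ku.
  by rewrite (@zterm0 b (k - 1)) ?add0r//; right; rewrite !intrD; lra.
have -> : zsec b u v = zterm b (k - 1) u v + zterm b k u v.
  rewrite /zsec (@floor_def _ _ (k - 1)) ?subrK// intrD.
  by rewrite ku andbT ltW.
by rewrite (@zterm0 b (k + 1)) ?addr0//; left; rewrite !intrD; lra.
Qed.

Lemma expi_int k : expi (2 * pi * k%:~R : R) = 1.
Proof.
have H n : expi (2 * pi * n%:R : R) = 1.
  elim: n => [|n IH]; first by rewrite mulr0 expi0.
  by rewrite -[n.+1%:R]natr1 mulrDr expiD IH mulr1 expi2pi mulr1.
case: k => n; first exact: H.
rewrite NegzE intrN mulrN.
have := expiD (- (2 * pi * n.+1%:R)) (2 * pi * n.+1%:R : R).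
by rewrite addNr expi0 H mulr1.
Qed.

Lemma zterm_quasi b k n m u v : zterm b (k + n) (u + n%:~R) (v + m%:~R) =
  expi (2 * pi * (n%:~R * v)) * zterm b k u v.
Proof.
rewrite /zterm intrD opprD addrACA subrr addr0 [RHS]mulrCA -expiD; congr (_ * _).
have -> : 2 * pi * (k%:~R + n%:~R) * (v + m%:~R) =
   2 * pi * (n%:~R * v) + 2 * pi * k%:~R * v + 2 * pi * ((k + n) * m)%:~R :> R.
  by rewrite intrM intrD; ring.
by rewrite [LHS]expiD expi_int mulr1.
Qed.

Lemma zsec_quasi b n m u v : zsec b (u + n%:~R) (v + m%:~R) =
  expi (2 * pi * (n%:~R * v)) * zsec b u v.
Proof.
rewrite /zsec floorDrz ?intr_int// intrKfloor (addrAC _ n 1).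
by rewrite !zterm_quasi -mulrDr.
Qed.

(** With x the fractional part of [u], the two values combine the same two terms with coefficients
    (1, 1) and (x, x - 1). This system has determinant -1, so both terms would vanish, but the bump
    is positive at x. *)
Lemma zsec_no_common_zero u v : zsec false u v = 0 -> zsec true u v <> 0.
Proof.
rewrite /zsec /zterm /= !intrD opprD addrA.
have := floor_le u; have := floorD1_gt u; rewrite intrD.
set x := u - _; move=> ux xu.
have x01 : 0 <= x < 1 by rewrite /x; apply/andP; split; lra.
have a0 : 0 < zbump x by apply: zbump_gt0; lra.
rewrite [1%:~R]mulr1z; set a := zbump x in a0 *; set c := zbump (x - 1).
rewrite !expr0 !expr1 !mul1r; set E1 := expi _; set E2 := expi _ => h0 h1.
have E1N : Normc.normc E1 = 1 by exact: normc_expi.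
have E1_neq0 : E1 != 0.
  by apply/eqP => E0; move: E1N; rewrite E0 Normc.normc0 => /eqP; rewrite eq_sym oner_eq0.
have cE : c%:C%C * E2 = 0.
  have : x%:C%C * (a%:C%C * E1 + c%:C%C * E2) - ((x * a)%:C%C * E1 + ((x - 1) * c)%:C%C * E2) = 0.
    by rewrite h0 h1 mulr0 subr0.
  have x1 : (x - 1)%:C%C = x%:C%C - 1 :> R[i].
    by apply/eqP; rewrite eq_complex /= subr0 !eqxx.
  by move=> <-; rewrite !rmorphM /= x1; ring.
move: h0; rewrite cE addr0 => /eqP; rewrite mulf_eq0 (negbTE E1_neq0) orbF.
by move=> /eqP[] /eqP; rewrite gt_eqF.
Qed.

Variable n : nat.

Lemma csmooth_zterm b k (i j : 'I_n) : csmooth (fun z : 'rV[R]_n => zterm b k (z 0 i) (z 0 j)).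
Proof.
have Cp N : Ck N (fun z : 'rV[R]_n => (z 0 i - k%:~R) ^+ b * zbump (z 0 i - k%:~R)).
  apply: CkM.
    case: b => /=; last first.
      have -> : (fun z : 'rV[R]_n => (z 0 i - k%:~R) ^+ false) = (fun=> 1) by [].
      exact: Ck_cst.
    have -> : (fun z : 'rV[R]_n => (z 0 i - k%:~R) ^+ true) = (fun z => z 0 i + - k%:~R) by [].
    by apply: CkD; [exact: Ck_coord|exact: Ck_cst].
  have -> : (fun z : 'rV[R]_n => zbump (z 0 i - k%:~R)) =
    (fun z => flat 0 (1 * z 0 i + (1 - k%:~R)) * flat 0 (-1 * z 0 i + (1 + k%:~R))).
    by apply/funext => z; rewrite /zbump; congr (flat _ _ * flat _ _); ring.
  by apply: CkM; exact: Ck_flat.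
split=> N.
  have -> : (fun z : 'rV[R]_n => complex.Re (zterm b k (z 0 i) (z 0 j))) = (fun z =>
    (z 0 i - k%:~R) ^+ b * zbump (z 0 i - k%:~R) * cos (2 * pi * k%:~R * z 0 j)).
    by apply/funext => z; rewrite /zterm /= mul0r subr0.
  by apply: CkM (Cp N) _; have [] := @Ck_trig R n N j (2 * pi * k%:~R).
have -> : (fun z : 'rV[R]_n => complex.Im (zterm b k (z 0 i) (z 0 j))) = (fun z =>
  (z 0 i - k%:~R) ^+ b * zbump (z 0 i - k%:~R) * sin (2 * pi * k%:~R * z 0 j)).
  by apply/funext => z; rewrite /zterm /= mul0r addr0.
by apply: CkM (Cp N) _; have [] := @Ck_trig R n N j (2 * pi * k%:~R).
Qed.

Lemma csmooth_zsec b (i j : 'I_n) : csmooth (fun z : 'rV[R]_n => zsec b (z 0 i) (z 0 j)).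
Proof.
apply: csmooth_local => z; set k := Num.floor (z 0 i).
exists (fun z => zterm b (k - 1) (z 0 i) (z 0 j) + zterm b k (z 0 i) (z 0 j)
   + zterm b (k + 1) (z 0 i) (z 0 j)).
  by apply: csmoothD; [apply: csmoothD|]; exact: csmooth_zterm.
have cz : {for z, continuous (fun z : 'rV[R]_n => z 0 i)} by exact: coord_continuous.
have h1 : \forall y \near z, (k - 1)%:~R < (y : 'rV[R]_n) 0 i.
  apply: (cz [set t | (k - 1)%:~R < t]); apply: lt_nbhsr.
  by rewrite intrD; have := floor_le (z 0 i); rewrite -/k; lra.
have h2 : \forall y \near z, (y : 'rV[R]_n) 0 i < (k + 1)%:~R.
  apply: (cz [set t | t < (k + 1)%:~R]); apply: lt_nbhsl.
  exact: floorD1_gt.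
by near=> y; apply: zsec_local; apply/andP; split; near: y.
Unshelve. all: by end_near. Qed.

End zak_section.

(** * Coefficients of a product of linear polynomials *)

Section sections_without_common_zero.
Variables (R : realType) (q : nat).
Implicit Types (z : 'rV[R]_(q + q)) (s : seq 'I_q).

Definition zpoly s z : {poly R[i]} :=
  \prod_(k <- s) ((zsec false (z 0 (lshift q k)) (z 0 (rshift q k)))%:P +
    zsec true (z 0 (lshift q k)) (z 0 (rshift q k)) *: 'X).

Lemma csmooth_zpoly s j : csmooth (fun z => (zpoly s z)`_j).
Proof.
elim: s j => [|k s IH] j.
  have -> : (fun z => (zpoly [::] z)`_j) = (fun=> (j == 0%N)%:R).
    by apply/funext => z; rewrite /zpoly big_nil coef1.
  exact: csmooth_cst.
have -> : (fun z => (zpoly (k :: s) z)`_j) = (fun z =>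
    zsec false (z 0 (lshift q k)) (z 0 (rshift q k)) * (zpoly s z)`_j +
    zsec true (z 0 (lshift q k)) (z 0 (rshift q k)) *
      (if j is j'.+1 then (zpoly s z)`_j' else 0)).
  apply/funext => z; rewrite /zpoly big_cons mulrDl coefD mulrC coefMC mulrC.
  by rewrite -scalerAl coefZ coefXM; case: j.
apply: csmoothD; apply: csmoothM; rewrite ?IH//; do ?exact: csmooth_zsec.
by case: j => [|j]; [exact: csmooth_cst|exact: IH].
Qed.

Lemma zpoly_quasi s z (D : 'rV[int]_(q + q)) : zpoly s (z + map_mx intr D) =
  expi (2 * pi * \sum_(k <- s) (D 0 (lshift q k))%:~R * z 0 (rshift q k)) *: zpoly s z.
Proof.
elim: s => [|k s IH]; first by rewrite /zpoly !big_nil mulr0 expi0 scale1r.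
rewrite /zpoly !big_cons -!/(zpoly _ _) IH [2 * pi * (_ + _)]mulrDr expiD !mxE !zsec_quasi.
by rewrite polyCM mul_polyC -scalerA -scalerDr -[LHS]scalerAl -(scalerAr _ _ (zpoly s z)) scalerA.
Qed.

Lemma zpoly_neq0 s z : zpoly s z != 0.
Proof.
elim: s => [|k s IH]; first by rewrite /zpoly big_nil oner_neq0.
rewrite /zpoly big_cons mulf_neq0//.
set u := z 0 (lshift q k); set v := z 0 (rshift q k).
apply/eqP => p0; apply: (@zsec_no_common_zero R u v).
  have := congr1 (fun p : {poly R[i]} => p`_0) p0.
  by rewrite coefD coefC coefZ coefX mulr0 addr0 coef0.
have := congr1 (fun p : {poly R[i]} => p`_1) p0.
by rewrite coefD coefC coefZ coefX mulr1 add0r coef0.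
Qed.

Lemma size_zpoly s z : (size (zpoly s z) <= (size s).+1)%N.
Proof.
elim: s => [|k s IH]; first by rewrite /zpoly big_nil size_poly1.
rewrite /zpoly big_cons; apply: leq_trans (size_polyMleq _ _) _.
set p := (_ + _); have : (size p <= 2)%N.
  apply: leq_trans (size_polyD _ _) _; rewrite geq_max.
  rewrite (leq_trans (size_polyC_leq1 _))//.
  by apply: leq_trans (size_scale_leq _ _) _; rewrite size_polyX.
move=> p2; apply: (@leq_trans (2 + (size s).+1).-1) => //.
by rewrite -!subn1 leq_sub2r// leq_add.
Qed.

Lemma exists_section_without_zero M : (q < M)%N ->
  exists F : 'rV[R]_(q + q) -> 'rV[R[i]]_M,
    [/\ forall j : 'I_M, csmooth (fun z => F z 0 j),
        zak_quasiperiodic F & forall z, F z <> 0].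
Proof.
move=> qM; pose F z : 'rV[R[i]]_M := \row_j (zpoly (enum 'I_q) z)`_j.
have FE j : (fun z => F z 0 j) = (fun z => (zpoly (enum 'I_q) z)`_j).
  by apply/funext => z; rewrite mxE.
have Fs (j : 'I_M) : csmooth (fun z => F z 0 j) by rewrite FE; exact: csmooth_zpoly.
exists F; split=> //.
  split=> [j|n m]; first exact: csmooth_cmeasurable.
  apply: aeW => z /=; have := zpoly_quasi (enum 'I_q) z (row_mx n m).
  have -> : z + map_mx intr (row_mx n m) =
      row_mx (lsubmx z + map_mx intr n) (rsubmx z + map_mx intr m).
    by rewrite map_row_mx -{1}(hsubmxK z) add_row_mx.
  move=> h; rewrite hsubmxK; apply/rowP => j; rewrite !mxE h coefZ big_enum /=.
  congr (expi (_ * _) * _); apply: eq_bigr => k _; rewrite row_mxEl.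
  by rewrite !mxE.
move=> z Fz; have /negP := zpoly_neq0 (enum 'I_q) z; apply; apply/eqP/polyP => j.
rewrite coef0; have [jM|Mj] := ltnP j M.
  by have := congr1 (fun w : 'rV[R[i]]_M => w 0 (Ordinal jM)) Fz; rewrite !mxE.
(* The degree is at most [q], so [F] contains every coefficient that can be nonzero. *)
apply: nth_default; apply: leq_trans (size_zpoly _ _) _.
by rewrite size_enum_ord; exact: leq_trans Mj.
Qed.

End sections_without_common_zero.

Theorem theorem1p10 (R : realType) (q M : nat) (hq : (1 <= q)%N)
    (hM : (1 <= M)%N) :
  ((M <= q)%N ->
    forall F : 'rV[R]_(q + q) -> 'rV[R[i]]_M,
      (ess_sup (@lebesgueRn R (q + q)) (fun z => (vnorm (F z))%:E) < +oo)%E ->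
      zak_quasiperiodic F ->
      (exists U : set 'rV[R]_(q + q),
        [/\ open U, box (const_mx (-2)) (const_mx 3) `<=` U
           & forall j : 'I_M, locally_VMO U (fun z => F z 0 j)]) ->
      ess_inf_on (box (const_mx 0) (const_mx 1)) (fun z => vnorm (F z)) = 0%E)
  /\
  ((q < M)%N ->
    exists F : 'rV[R]_(q + q) -> 'rV[R[i]]_M,
      [/\ forall j : 'I_M, csmooth (fun z => F z 0 j),
          zak_quasiperiodic F
        & forall z, F z <> 0]).
Proof.
split=> [Mq F Fb Fz Fvmo|qM]; first exact: vmo_ess_inf0.
exact: exists_section_without_zero.
Qed.
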